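(* Let $\vec s\in\mathbb Z_{\le0}^k$. Then the limit $\lim_{\vec r\to-\vec s}\zeta(\vec s;\vec r)^{(\Sigma(\vec s))}$, taken over $\vec r\in\mathbb R_{>0}^k$, exists.
   Context: For $\vec s\in\mathbb Z^k$, $\vec r\in\mathbb R_{>0}^k$, $\mathrm{Re}\,\varepsilon<0$: $Z(\vec s;\vec r;\varepsilon)=\sum_{n_1>\dots>n_k>0}e^{\varepsilon(n_1r_1+\dots+n_kr_k)}n_1^{-s_1}\cdots n_k^{-s_k}$. For $\vec s\in\mathbb Z_{\le0}^k$ this is (the germ of) a convergent Laurent series in $\varepsilon$ at $0$, denoted $\overline Z(\vec s;\vec r;\varepsilon)\in R=\mathbb C[[\varepsilon,\varepsilon^{-1}]$ (formal Laurent series with finitely many negative powers); $\overline Z$ of the empty word is $1$. Let $P(\sum_na_n\varepsilon^n)=\sum_{n\le-1}a_n\varepsilon^n$. For a word $w=((s_1,r_1),\dots,(s_k,r_k))$ define recursively $\overline Z_-(w)=-P\big(\overline Z(w)+\sum_{j=1}^{k-1}\overline Z_-(w_{\le j})\overline Z(w_{>j})\big)$, $\overline Z_+(w)=(\mathrm{id}-P)\big(\overline Z(w)+\sum_{j=1}^{k-1}\overline Z_-(w_{\le j})\overline Z(w_{>j})\big)$ ($w_{\le j},w_{>j}$ the initial/final segments), and $\zeta(\vec s;\vec r)=\overline Z_+(\vec s;\vec r;\varepsilon)|_{\varepsilon=0}\in\mathbb C$. $\Sigma(\vec s)\subseteq\Sigma_k$ is the subgroup of permutations preserving each maximal block of consecutive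 indices $i$ with $s_i=0$ and fixing the other indices; $\sigma(\vec r)=(r_{\sigma(1)},\dots,r_{\sigma(k)})$ and $f(\vec r)^{(\Sigma(\vec s))}=\sum_{\sigma\in\Sigma(\vec s)}f(\sigma(\vec r))$. *)

(* Defs.v *)
From Stdlib Require Import Reals ZArith List Classical ClassicalEpsilon.
From Coquelicot Require Import Coquelicot.
Import ListNotations.
Open Scope R_scope.

Fixpoint rsum (f : nat -> R) (n : nat) : R :=
  match n with O => 0 | S n' => rsum f n' + f n' end.

Definition word := list (Z * R).

Fixpoint Zpart (w : word) (m : nat) (eps : R) : R :=
  match w with
  | nil => 1
  | (s, r) :: w' =>
      rsum (fun n => if Nat.eqb n 0 then 0
                     else exp (eps * (INR n * r)) * powerRZ (INR n) (- s)
                          * Zpart w' n eps) m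
  end.

(* Z(w; eps) = sum_{n_1 > ... > n_k > 0} ... (for eps < 0) *)
Definition Zfun (w : word) (eps : R) : R :=
  real (Lim_seq (fun m => Zpart w m eps)).

(* Formal Laurent series with finitely many negative powers:
   Laurent N a  represents  sum_{j >= 0} a j * eps^(j - N). *)
Record laurent := Laurent { lord : nat; lcoef : nat -> R }.

Definition laurent_coef (x : laurent) (n : Z) : R :=
  if Z.ltb (n + Z.of_nat (lord x)) 0 then 0
  else lcoef x (Z.to_nat (n + Z.of_nat (lord x))).

Definition is_laurent_expansion (f : R -> R) (x : laurent) : Prop :=
  exists rho, 0 < rho /\
    forall eps, -rho < eps < 0 ->
      is_series (fun j => lcoef x j * powerRZ eps (Z.of_nat j - Z.of_nat (lord x)))
                (f eps).

Definition lzero : laurent := Laurent 0 (fun _ => 0).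

Definition Zbar (w : word) : laurent :=
  epsilon (inhabits lzero) (is_laurent_expansion (Zfun w)).

Definition ladd (x y : laurent) : laurent :=
  let N := Nat.max (lord x) (lord y) in
  Laurent N (fun j => laurent_coef x (Z.of_nat j - Z.of_nat N)
                      + laurent_coef y (Z.of_nat j - Z.of_nat N)).

Definition lopp (x : laurent) : laurent :=
  Laurent (lord x) (fun j => - lcoef x j).

Definition lmul (x y : laurent) : laurent :=
  Laurent (lord x + lord y)
          (fun j => rsum (fun i => lcoef x i * lcoef y (j - i)) (S j)).

Definition lpolar (x : laurent) : laurent :=
  Laurent (lord x) (fun j => if Nat.ltb j (lord x) then lcoef x j else 0).

Definition lregular (x : laurent) : laurent :=
  Laurent (lord x) (fun j => if Nat.ltb j (lord x) then 0 else lcoef x j).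

Definition lsum (l : list laurent) : laurent := fold_right ladd lzero l.

Definition conv_sum (zm : word -> laurent) (w : word) : laurent :=
  lsum (map (fun j => lmul (zm (firstn j w)) (Zbar (skipn j w)))
            (seq 1 (length w - 1))).

(* \overline Z_-, defined by recursion on the length (fuel >= length) *)
Fixpoint Zminus_aux (fuel : nat) (w : word) : laurent :=
  match fuel with
  | O => lzero
  | S f => lopp (lpolar (ladd (Zbar w) (conv_sum (Zminus_aux f) w)))
  end.

Definition Zminus (w : word) : laurent := Zminus_aux (length w) w.

Definition Zplus (w : word) : laurent :=
  lregular (ladd (Zbar w) (conv_sum Zminus w)).

Definition zeta_reg (w : word) : R := laurent_coef (Zplus w) 0.

(* vectors of length k are functions on indices 0..k-1 *)
Definition mkword (k : nat) (s : nat -> Z) (r : nat -> R) : word :=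
  map (fun i => (s i, r i)) (seq 0 k).

Definition zeta (k : nat) (s : nat -> Z) (r : nat -> R) : R :=
  zeta_reg (mkword k s r).

Fixpoint all_lists (k n : nat) : list (list nat) :=
  match n with
  | O => [nil]
  | S n' => flat_map (fun l => map (fun a => a :: l) (seq 0 k)) (all_lists k n')
  end.

(* l (as the map i |-> nth i l 0) is injective on {0..k-1}, hence a permutation *)
Definition is_perm_b (k : nat) (l : list nat) : bool :=
  forallb (fun i => forallb (fun j => Nat.eqb i j
             || negb (Nat.eqb (nth i l 0%nat) (nth j l 0%nat)))%bool (seq 0 k)) (seq 0 k).

(* i and j lie in the same maximal block of consecutive indices m with s_m = 0 *)
Definition same_zero_block (s : nat -> Z) (i j : nat) : bool :=
  forallb (fun m => Z.eqb (s m) 0)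
          (seq (Nat.min i j) (Nat.max i j - Nat.min i j + 1)).

Definition in_Sigma (k : nat) (s : nat -> Z) (l : list nat) : bool :=
  (is_perm_b k l &&
  forallb (fun i => Nat.eqb (nth i l 0%nat) i || same_zero_block s i (nth i l 0%nat))%bool
          (seq 0 k))%bool.

Definition zeta_sym (k : nat) (s : nat -> Z) (r : nat -> R) : R :=
  fold_right Rplus 0
    (map (fun l => if in_Sigma k s l then zeta k s (fun i => r (nth i l 0%nat)) else 0)
         (all_lists k k)).

(* Main.v *)
(* Put eps^(wt w) Z(w; eps) into the ring of power series, so that Z becomes a functional phi on
   words whose letters are pairs (-s, r) with r a function on the parameter space. Singularities
   of the renormalised values at r = -s can only come from consecutive sums of the r_i inside a
   block of zeros, and they are removed before renormalising. For an arbitrary functional C on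
   words with purely polar values, the Birkhoff decompositions of phi and of psi = C * phi
   (convolution for deconcatenation) have the same regular part. Take C supported on words of
   zeros, with symmetrisation over a block S given by the recursion
     C(b :: S) = (1 / (eps b)) C(S) - sum_c C(S with c replaced by b + c).
   The functional equation Q(x) Q(y) = Q(x + y) (1 + Q(x) + Q(y)) of Q(y) = e^y / (1 - e^y)
   gives, for symmetrised blocks, the same recursion for phi with 1 / (eps b) replaced by
   Q(eps b), except that removing b shifts the argument of what follows the block. Hence in the
   recursion for psi the pole of Q(eps b) at b = 0 is absorbed in a divided difference, and the
   symmetrised coefficients of psi converge by induction on the size of the block. Symmetrised
   convolutions are sums, over all ways of cutting a symmetrised word, of products of symmetrised
   factors, so convergence passes through the recursion defining the Birkhoff decomposition of
   psi. *)

Require Import Defs.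
From Stdlib Require Import Reals ZArith List Lia Lra FunctionalExtensionality Permutation ClassicalEpsilon.
From Coquelicot Require Import Coquelicot.
Import ListNotations.
Open Scope R_scope.

(** * Power series and families of power series *)

(** The shift caused by removing a letter is what shapes the induction: the claim about a block must
    hold for every continuation, so it is stated for an arbitrary function G of the sum of the
    preceding letters, and each removal trades G for a shift and a divided difference of G. This is
    why divided differences of every order are controlled. Letters carry functions of the parameters
    instead of numbers because the recursion creates letters b + c; such a sum is again positive and
    tends to 0, so the induction stays in one class and the limit is taken along a filter only at
    the end. Of C only the polarity and the sums over rearrangements enter, so a symmetric value can
    be distributed evenly over the rearrangements. The factor eps^(wt w) is multiplicative under
    concatenation and turns the projection P into truncation below index wt w, the same index for
    all rearrangements of a word; hence P commutes with symmetrisation. The link with analysis is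
    uniqueness of expansions to the left of 0: it pins down the series chosen by [epsilon] in
    [Zbar], and it turns the functional equation of Q into an identity of coefficients. *)

Definition series := nat -> R.

Definition stail (a : series) : series := fun n => a (S n).

(** Peeling off the constant term of the left factor, [a = a 0 + eps * stail a], gives the ring laws
    by plain induction on the index. *)
Fixpoint cauchy_coef (n : nat) (a b : series) : R :=
  match n with
  | O => a O * b O
  | S m => a O * b (S m) + cauchy_coef m (stail a) b
  end.

Definition sconst (c : R) : series := fun n => match n with O => c | S _ => 0 end.
Definition sadd (a b : series) : series := fun n => a n + b n.
Definition sopp (a : series) : series := fun n => - a n.
Definition ssub (a b : series) : series := fun n => a n - b n.
Definition smul (a b : series) : series := fun n => cauchy_coef n a b.
Definition seps : series := fun n => match n with 1%nat => 1 | _ => 0 end.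

Lemma cauchy_scal_l n c a b : cauchy_coef n (fun i => c * a i) b = c * cauchy_coef n a b.
Proof.
  revert a; induction n as [|n IH]; intros a; simpl; [ring|].
  unfold stail; simpl. rewrite (IH (fun i => a (S i))). unfold stail. ring.
Qed.

Lemma cauchy_add_l n a a' b :
  cauchy_coef n (fun i => a i + a' i) b = cauchy_coef n a b + cauchy_coef n a' b.
Proof.
  revert a a'; induction n as [|n IH]; intros a a'; simpl; [ring|].
  unfold stail; simpl. rewrite (IH (fun i => a (S i)) (fun i => a' (S i))). ring.
Qed.

Lemma cauchy_0_l n b : cauchy_coef n (fun _ => 0) b = 0.
Proof.
  induction n as [|n IH]; simpl; [ring|]. unfold stail; simpl; rewrite IH; ring.
Qed.

Lemma cauchy_1_l n b : cauchy_coef n (sconst 1) b = b n.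
Proof.
  destruct n as [|n]; simpl; [ring|].
  change (stail (sconst 1)) with (fun _ : nat => 0). rewrite cauchy_0_l; ring.
Qed.

Lemma cauchy_S_r n a b : cauchy_coef (S n) a b = a (S n) * b O + cauchy_coef n a (stail b).
Proof.
  revert a; induction n as [|n IH]; intros a; [simpl; unfold stail; ring|].
  change (cauchy_coef (S (S n)) a b) with (a O * b (S (S n)) + cauchy_coef (S n) (stail a) b).
  rewrite IH; simpl; unfold stail; ring.
Qed.

Lemma cauchy_comm n a b : cauchy_coef n a b = cauchy_coef n b a.
Proof.
  revert a b; induction n as [|n IH]; intros a b; [simpl; ring|].
  rewrite cauchy_S_r; simpl; rewrite IH; ring.
Qed.

Lemma cauchy_assoc n a b c : cauchy_coef n (smul a b) c = cauchy_coef n a (smul b c).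
Proof.
  revert a; induction n as [|n IH]; intros a; [simpl; unfold smul; simpl; ring|].
  simpl. rewrite <- IH.
  change (stail (smul a b)) with (fun i => a O * stail b i + smul (stail a) b i).
  rewrite cauchy_add_l, (cauchy_scal_l n (a O) (stail b)).
  unfold smul; simpl; unfold stail; simpl. ring.
Qed.

Lemma series_ring_theory :
  ring_theory (sconst 0) (sconst 1) sadd smul ssub sopp (@eq series).
Proof.
  split; intros; apply functional_extensionality; intros n;
    unfold sadd, ssub, sopp, smul; try ring.
  - destruct n; simpl; ring.
  - apply cauchy_1_l.
  - apply cauchy_comm.
  - symmetry; apply cauchy_assoc.
  - apply cauchy_add_l.
  - destruct n; simpl; ring.
Qed.
Add Ring series_ring : series_ring_theory.

Lemma rsum_shift f n : rsum f (S n) = f O + rsum (fun i => f (S i)) n.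
Proof.
  induction n as [|n IH]; [simpl; ring|].
  change (rsum f (S (S n))) with (rsum f (S n) + f (S n)). rewrite IH; simpl; ring.
Qed.

Lemma rsum_ext f g n : (forall i, (i < n)%nat -> f i = g i) -> rsum f n = rsum g n.
Proof.
  induction n as [|n IH]; intros H; simpl; [reflexivity|].
  rewrite IH, H by auto with arith; reflexivity.
Qed.

Lemma rsum_zero f n : (forall i, (i < n)%nat -> f i = 0) -> rsum f n = 0.
Proof.
  induction n as [|n IH]; intros H; simpl; [reflexivity|].
  rewrite IH, H by auto with arith; ring.
Qed.

Lemma smul_rsum a b n : smul a b n = rsum (fun i => a i * b (n - i)%nat) (S n).
Proof.
  unfold smul. revert a; induction n as [|n IH]; intros a; [simpl; ring|].
  rewrite rsum_shift; simpl cauchy_coef. rewrite IH. reflexivity.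
Qed.

Lemma smul_eps a n : smul seps a n = match n with O => 0 | S m => a m end.
Proof.
  unfold smul; destruct n as [|n]; simpl; [ring|].
  replace (stail seps) with (sconst 1) by
    (apply functional_extensionality; intros [|[|]]; reflexivity).
  rewrite cauchy_1_l; ring.
Qed.

(** Infinite parameter sequences avoid any dependence on the length; [param_filter] later constrains
    the first [k] coordinates. *)
Definition X := nat -> posreal.
Definition V := X -> R.
Definition fam := X -> series.

Definition fconst (v : V) : fam := fun x => sconst (v x).
Definition fadd (f g : fam) : fam := fun x => sadd (f x) (g x).
Definition fopp (f : fam) : fam := fun x => sopp (f x).
Definition fsub (f g : fam) : fam := fun x => ssub (f x) (g x).
Definition fmul (f g : fam) : fam := fun x => smul (f x) (g x).
Definition f0 : fam := fun _ => sconst 0.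
Definition f1 : fam := fun _ => sconst 1.
Definition feps : fam := fun _ => seps.

Declare Scope fam_scope.
Delimit Scope fam_scope with fam.
Bind Scope fam_scope with fam.
Infix "+" := fadd : fam_scope.
Infix "*" := fmul : fam_scope.
Infix "-" := fsub : fam_scope.
Notation "- f" := (fopp f) : fam_scope.

Lemma fam_ring_theory : ring_theory f0 f1 fadd fmul fsub fopp (@eq fam).
Proof.
  split; intros; apply functional_extensionality; intros a;
    unfold fadd, fsub, fopp, fmul, f0, f1; ring.
Qed.
Add Ring fam_ring : fam_ring_theory.

Fixpoint fpow (f : fam) (n : nat) : fam :=
  match n with O => f1 | S m => (f * fpow f m)%fam end.

Lemma fam_ext (f g : fam) : (forall x n, f x n = g x n) -> f = g.
Proof. intros H; apply functional_extensionality; intros x; apply functional_extensionality, H. Qed.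

Fixpoint Sum {T} (l : list T) (f : T -> fam) : fam :=
  match l with nil => f0 | a :: l' => (f a + Sum l' f)%fam end.

Lemma Sum_app {T} (l l' : list T) (f : T -> fam) : Sum (l ++ l') f = (Sum l f + Sum l' f)%fam.
Proof. induction l as [|a l IH]; simpl; [ring|rewrite IH; ring]. Qed.

Lemma Sum_ext_in {T} (l : list T) (f g : T -> fam) : (forall a, In a l -> f a = g a) -> Sum l f = Sum l g.
Proof.
  induction l as [|a l IH]; intros H; simpl; [reflexivity|].
  rewrite H, IH; auto with datatypes.
Qed.

Lemma Sum_ext {T} (l : list T) (f g : T -> fam) : (forall a, f a = g a) -> Sum l f = Sum l g.
Proof. intros H; apply Sum_ext_in; auto. Qed.

Lemma Sum_zero {T} (l : list T) (f : T -> fam) : (forall a, In a l -> f a = f0) -> Sum l f = f0.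
Proof.
  induction l as [|a l IH]; intros H; simpl; [reflexivity|].
  rewrite H, IH by auto with datatypes; ring.
Qed.

Lemma Sum_add {T} (l : list T) (f g : T -> fam) : Sum l (fun a => f a + g a)%fam = (Sum l f + Sum l g)%fam.
Proof. induction l as [|a l IH]; simpl; [ring|rewrite IH; ring]. Qed.

Lemma Sum_mul_l {T} (l : list T) (c : fam) (f : T -> fam) : Sum l (fun a => c * f a)%fam = (c * Sum l f)%fam.
Proof. induction l as [|a l IH]; simpl; [ring|rewrite IH; ring]. Qed.

Lemma Sum_mul_r {T} (l : list T) (c : fam) (f : T -> fam) : Sum l (fun a => f a * c)%fam = (Sum l f * c)%fam.
Proof. induction l as [|a l IH]; simpl; [ring|rewrite IH; ring]. Qed.

Lemma Sum_opp {T} (l : list T) (f : T -> fam) : Sum l (fun a => - f a)%fam = (- Sum l f)%fam.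
Proof. induction l as [|a l IH]; simpl; [ring|rewrite IH; ring]. Qed.

Lemma Sum_map {T U} (l : list T) (h : T -> U) (f : U -> fam) : Sum (map h l) f = Sum l (fun a => f (h a)).
Proof. induction l as [|a l IH]; simpl; [reflexivity|rewrite IH; reflexivity]. Qed.

Lemma Sum_flat_map {T U} (l : list T) (h : T -> list U) (f : U -> fam) :
  Sum (flat_map h l) f = Sum l (fun a => Sum (h a) f).
Proof. induction l as [|a l IH]; simpl; [reflexivity|rewrite Sum_app, IH; reflexivity]. Qed.

Lemma Sum_swap {T U} (l : list T) (l' : list U) (f : T -> U -> fam) :
  Sum l (fun a => Sum l' (f a)) = Sum l' (fun b => Sum l (fun a => f a b)).
Proof.
  induction l as [|a l IH]; simpl.
  - symmetry; apply Sum_zero; reflexivity.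
  - rewrite IH, <- Sum_add; reflexivity.
Qed.

(** * Permutations, splittings and cuts *)

Section combinatorics.
Context {T : Type}.

Fixpoint ins (b : T) (u : list T) : list (list T) :=
  match u with
  | nil => [[b]]
  | c :: u' => (b :: c :: u') :: map (cons c) (ins b u')
  end.

Fixpoint perms (S : list T) : list (list T) :=
  match S with nil => [nil] | b :: S' => flat_map (ins b) (perms S') end.

Fixpoint splits (S : list T) : list (list T * list T) :=
  match S with
  | nil => [(nil, nil)]
  | b :: S' => flat_map (fun p => [(b :: fst p, snd p); (fst p, b :: snd p)]) (splits S')
  end.

Fixpoint lcuts (u : list T) : list (list T * list T) :=
  match u with
  | nil => [(nil, nil)]
  | c :: u' => (nil, u) :: map (fun p => (c :: fst p, snd p)) (lcuts u')
  end.

Lemma Sum_lcuts_cons c (u : list T) h :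
  Sum (lcuts (c :: u)) h
  = (h ([], c :: u) + Sum (lcuts u) (fun p => h (c :: fst p, snd p)))%fam.
Proof. simpl; rewrite Sum_map; reflexivity. Qed.

Lemma Sum_ins_cons b c (u : list T) (h : list T -> fam) :
  Sum (ins b (c :: u)) h = (h (b :: c :: u) + Sum (ins b u) (fun w => h (c :: w)))%fam.
Proof. simpl; rewrite Sum_map; reflexivity. Qed.

(** Once a word containing [b] is cut, [b] lies on one side; deleting it leaves a cut of [u]
    together with an insertion on that side. *)
Lemma Sum_lcuts_ins b (u : list T) (h : list T -> list T -> fam) :
  Sum (ins b u) (fun w => Sum (lcuts w) (fun p => h (fst p) (snd p)))
  = Sum (lcuts u) (fun p => Sum (ins b (fst p)) (fun w => h w (snd p))
                            + Sum (ins b (snd p)) (h (fst p)))%fam.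
Proof.
  revert h; induction u as [|c u IH]; intros h.
  - simpl; ring.
  - rewrite Sum_ins_cons, !Sum_lcuts_cons; simpl fst; simpl snd.
    rewrite (Sum_ext (ins b u) _ (fun w => h [] (c :: w)
       + Sum (lcuts w) (fun p => h (c :: fst p) (snd p)))%fam)
      by (intros w; rewrite Sum_lcuts_cons; reflexivity).
    rewrite Sum_add, (IH (fun w1 w2 => h (c :: w1) w2)), Sum_ins_cons.
    rewrite !Sum_add.
    rewrite (Sum_ext (lcuts u) (fun a => Sum (ins b (c :: fst a)) (fun w => h w (snd a)))
      (fun a => h (b :: c :: fst a) (snd a) + Sum (ins b (fst a)) (fun w => h (c :: w) (snd a)))%fam)
      by (intros w; rewrite Sum_ins_cons; reflexivity).
    rewrite Sum_add. cbn [fst snd ins Sum].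
    change (fun a => Sum (ins b (snd a)) (fun w2 => h (c :: fst a) w2))
      with (fun a : list T * list T => Sum (ins b (snd a)) (h (c :: fst a))).
    ring.
Qed.

Lemma Sum_perms_cons b S (h : list T -> fam) :
  Sum (perms (b :: S)) h = Sum (perms S) (fun u => Sum (ins b u) h).
Proof. simpl; apply Sum_flat_map. Qed.

Lemma Sum_splits_cons b S (h : list T * list T -> fam) :
  Sum (splits (b :: S)) h
  = (Sum (splits S) (fun p => h (b :: fst p, snd p))
     + Sum (splits S) (fun p => h (fst p, b :: snd p)))%fam.
Proof.
  simpl; rewrite Sum_flat_map, <- Sum_add; apply Sum_ext; intros p; simpl; ring.
Qed.

(** Cutting an arbitrary rearrangement amounts to distributing the letters over the two sides and
    rearranging each side independently. *)
Lemma Sum_perms_lcuts S (h : list T -> list T -> fam) :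
  Sum (perms S) (fun u => Sum (lcuts u) (fun p => h (fst p) (snd p)))
  = Sum (splits S) (fun p => Sum (perms (fst p)) (fun u => Sum (perms (snd p)) (h u))).
Proof.
  revert h; induction S as [|b S IH]; intros h.
  - simpl; ring.
  - rewrite Sum_perms_cons, Sum_splits_cons.
    rewrite (Sum_ext (perms S) _ _ (fun u => Sum_lcuts_ins b u h)).
    rewrite (IH (fun u1 u2 => Sum (ins b u1) (fun w => h w u2) + Sum (ins b u2) (h u1))%fam).
    rewrite <- Sum_add; apply Sum_ext; intros [T1 U1]; simpl fst; simpl snd.
    rewrite Sum_perms_cons.
    rewrite (Sum_ext (perms T1) (fun u => Sum (perms (b :: U1)) (h u))
       _ (fun u => Sum_perms_cons b U1 (h u))).
    rewrite <- Sum_add; apply Sum_ext; intros u. rewrite Sum_add. f_equal.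
    apply Sum_swap.
Qed.

Lemma splits_in (P : T -> Prop) S p :
  In p (splits S) -> List.Forall P S -> List.Forall P (fst p) /\ List.Forall P (snd p).
Proof.
  revert p; induction S as [|b S IH]; simpl; intros p Hp HS.
  - destruct Hp as [<-|[]]; auto.
  - apply in_flat_map in Hp as [p' [Hp' Hp]]. inversion HS; subst.
    destruct (IH p' Hp' H2). destruct Hp as [<-|[<-|[]]]; simpl; auto.
Qed.

Lemma splits_length S p :
  In p (splits S) -> (length (fst p) + length (snd p) = length S)%nat.
Proof.
  revert p; induction S as [|b S IH]; simpl; intros p Hp.
  - destruct Hp as [<-|[]]; auto.
  - apply in_flat_map in Hp as [p' [Hp' Hp]]. specialize (IH p' Hp').
    destruct Hp as [<-|[<-|[]]]; simpl; lia.
Qed.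

Lemma ins_perm b (u w : list T) : In w (ins b u) -> Permutation (b :: u) w.
Proof.
  revert w; induction u as [|c u IH]; simpl; intros w H.
  - destruct H as [<-|[]]; auto.
  - destruct H as [<-|H]; auto.
    apply in_map_iff in H as [w' [<- H]].
    rewrite perm_swap. auto.
Qed.

Lemma perms_perm (S w : list T) : In w (perms S) -> Permutation S w.
Proof.
  revert w; induction S as [|b S IH]; simpl; intros w H.
  - destruct H as [<-|[]]; auto.
  - apply in_flat_map in H as [u [Hu H]]. rewrite (IH u Hu). apply ins_perm; auto.
Qed.

(* A pattern [(S0, [(l1, S1); ...; (lm, Sm)])] stands for the words
   [u0 l1 u1 ... lm um] with each [ui] a rearrangement of [Si]. *)
Definition pattern := (list T * list (T * list T))%type.

Fixpoint qwords (q : list (T * list T)) : list (list T) :=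
  match q with
  | nil => [nil]
  | (l, B) :: q' =>
      map (cons l) (flat_map (fun u => map (app u) (qwords q')) (perms B))
  end.

Definition words (p : pattern) : list (list T) :=
  flat_map (fun u => map (app u) (qwords (snd p))) (perms (fst p)).

Lemma Sum_words S q (h : list T -> fam) :
  Sum (words (S, q)) h = Sum (perms S) (fun u => Sum (qwords q) (fun v => h (u ++ v))).
Proof.
  unfold words; rewrite Sum_flat_map; apply Sum_ext; intros u; apply Sum_map.
Qed.

Lemma Sum_qwords_cons l S q (h : list T -> fam) :
  Sum (qwords ((l, S) :: q)) h = Sum (words (S, q)) (fun v => h (l :: v)).
Proof. simpl; rewrite Sum_map; reflexivity. Qed.

(** A cut falls within the leading block or at its end, where it splits the letters of the block, or
    beyond the letter [l], where it leaves the block whole. *)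
Fixpoint qcuts (S : list T) (q : list (T * list T)) : list (pattern * pattern) :=
  map (fun s => ((fst s, []), (snd s, q))) (splits S)
  ++ match q with
     | nil => []
     | (l, S') :: q' =>
         map (fun c => ((S, (l, fst (fst c)) :: snd (fst c)), snd c)) (qcuts S' q')
     end.

Fixpoint conv (f g : list T -> fam) (w : list T) : fam :=
  match w with
  | nil => (f nil * g nil)%fam
  | l :: w' => (f nil * g w + conv (fun v => f (l :: v)) g w')%fam
  end.

Lemma conv_app f g u v :
  conv f g (u ++ v)
  = (Sum (lcuts u) (fun p => f (fst p) * g (snd p ++ v))
     + match v with
       | nil => f0
       | l :: v' => conv (fun w => f (u ++ l :: w)) g v'
       end)%fam.
Proof.
  revert f; induction u as [|c u IH]; intros f.
  - destruct v; simpl; ring.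
  - rewrite Sum_lcuts_cons; simpl app; simpl conv. rewrite IH. simpl. ring.
Qed.

Lemma Sum_conv S q f g :
  Sum (words (S, q)) (conv f g)
  = Sum (qcuts S q) (fun c => Sum (words (fst c)) f * Sum (words (snd c)) g)%fam.
Proof.
  revert S f; induction q as [|[l S'] q IH]; intros S f.
  - simpl. rewrite Sum_words, app_nil_r, Sum_map.
    rewrite (Sum_ext (perms S) _ (fun u => Sum (lcuts u) (fun p => f (fst p) * g (snd p))%fam)).
    2:{ intros u; simpl qwords; simpl Sum. rewrite conv_app.
        rewrite (Sum_ext _ _ (fun p => f (fst p) * g (snd p))%fam);
          [ring|intros p; rewrite app_nil_r; reflexivity]. }
    rewrite (Sum_perms_lcuts S (fun u v => f u * g v)%fam).
    apply Sum_ext; intros [T1 U1]; simpl fst; simpl snd.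
    rewrite (Sum_words T1 [] f), (Sum_words U1 [] g), <- Sum_mul_r.
    apply Sum_ext; intros u; rewrite <- Sum_mul_l; simpl.
    rewrite app_nil_r.
    apply Sum_ext_in; intros v _; simpl; rewrite app_nil_r; ring.
  - simpl qcuts. rewrite Sum_app, !Sum_map. simpl fst; simpl snd.
    rewrite Sum_words.
    rewrite (Sum_ext (perms S) _ (fun u =>
       Sum (lcuts u) (fun p => f (fst p) * Sum (qwords ((l, S') :: q)) (fun v => g (snd p ++ v)))
       + Sum (words (S', q)) (conv (fun w => f (u ++ l :: w)) g))%fam).
    2:{ intros u. rewrite !Sum_qwords_cons.
        rewrite (Sum_ext (words (S', q)) _ (fun v =>
          Sum (lcuts u) (fun p => f (fst p) * g (snd p ++ l :: v))
          + conv (fun w => f (u ++ l :: w)) g v)%fam) by (intros v; apply conv_app).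
        rewrite Sum_add, Sum_swap. f_equal.
        apply Sum_ext; intros p; rewrite Sum_mul_l, Sum_qwords_cons; reflexivity. }
    rewrite Sum_add. f_equal.
    + rewrite (Sum_perms_lcuts S (fun u u' =>
        f u * Sum (qwords ((l, S') :: q)) (fun v => g (u' ++ v)))%fam).
      apply Sum_ext; intros [T1 U1]; simpl fst; simpl snd.
      rewrite (Sum_words T1 [] f), (Sum_words U1 _ g), <- Sum_mul_r.
      apply Sum_ext; intros u. rewrite Sum_mul_l. f_equal. simpl. rewrite app_nil_r; ring.
    + rewrite (Sum_ext (perms S) _ _ (fun u => IH S' (fun w => f (u ++ l :: w)))).
      rewrite Sum_swap. apply Sum_ext; intros [[T1 q1] p2]; simpl fst; simpl snd.
      rewrite Sum_mul_r. f_equal. rewrite Sum_words. apply Sum_ext; intros u.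
      rewrite Sum_qwords_cons. reflexivity.
Qed.

Definition psize (p : pattern) : nat :=
  (length (fst p) + fold_right (fun t m => S (length (snd t)) + m) 0 (snd p))%nat.

Definition pforall (P Q : T -> Prop) (p : pattern) : Prop :=
  List.Forall P (fst p) /\ List.Forall (fun t => Q (fst t) /\ List.Forall P (snd t)) (snd p).

Lemma qcuts_spec P Q S q c :
  In c (qcuts S q) -> pforall P Q (S, q) ->
  pforall P Q (fst c) /\ pforall P Q (snd c)
  /\ (psize (fst c) + psize (snd c) = psize (S, q))%nat.
Proof.
  revert S c; induction q as [|[l S'] q IH]; intros S c Hc [HS Hq]; simpl in HS, Hq;
    simpl qcuts in Hc.
  - rewrite app_nil_r in Hc. apply in_map_iff in Hc as [s [<- Hs]].
    destruct (splits_in P S s Hs HS). pose proof (splits_length S s Hs).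
    unfold pforall, psize; simpl; repeat split; auto; lia.
  - inversion Hq as [|? ? [Hl HS'] Hq']; subst; simpl in *.
    apply in_app_or in Hc as [Hc|Hc]; apply in_map_iff in Hc as [s [<- Hs]].
    + destruct (splits_in P S s Hs HS). pose proof (splits_length S s Hs).
      unfold pforall, psize; simpl; repeat split; auto; lia.
    + destruct (IH S' s Hs (conj HS' Hq')) as [[A1 A2] [[B1 B2] C]].
      destruct s as [[T1 q1] [T2 q2]].
      unfold psize, pforall in *; simpl in *.
      repeat split; auto; lia.
Qed.

Lemma psize_0 p : psize p = 0%nat -> p = ([], []).
Proof.
  destruct p as [[|a S] [|t q]]; unfold psize; simpl; intros; try lia; reflexivity.
Qed.

End combinatorics.
Arguments pattern : clear implicits.

(** * Convolution of functionals and Birkhoff decomposition *)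

Section convolution.
Context {T : Type}.
Implicit Types (f g h : list T -> fam).

Lemma conv_add_l f f' g w :
  conv (fun v => f v + f' v)%fam g w = (conv f g w + conv f' g w)%fam.
Proof.
  revert f f'; induction w as [|l w IH]; intros f f'; simpl; [ring|].
  rewrite (IH (fun v => f (l :: v)) (fun v => f' (l :: v))); ring.
Qed.

Lemma conv_scal_l c f g w : conv (fun v => c * f v)%fam g w = (c * conv f g w)%fam.
Proof.
  revert f; induction w as [|l w IH]; intros f; simpl; [ring|].
  rewrite (IH (fun v => f (l :: v))); ring.
Qed.

Lemma conv_assoc f g h w : conv (conv f g) h w = conv f (conv g h) w.
Proof.
  revert f; induction w as [|l w IH]; intros f; simpl; [ring|].
  rewrite <- IH.
  rewrite (conv_add_l (fun v => f [] * g (l :: v))%fam), (conv_scal_l (f []) (fun v => g (l :: v))). ring.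
Qed.

(** [nil0] restricts a convolution to cuts into two nonempty factors, as in the recursion for the
    decomposition. [nil1] restores the unit value: [bminus] itself is 0 on the empty word. *)
Definition nil0 f : list T -> fam := fun w => match w with nil => f0 | _ => f w end.
Definition nil1 f : list T -> fam := fun w => match w with nil => f1 | _ => f w end.

(** Since [g] kills the empty suffix, only proper prefixes reach the left factor; recursions through
    such a convolution are therefore well founded. *)
Lemma conv_local f f' g w :
  g [] = f0 -> (forall v, (length v < length w)%nat -> f v = f' v) ->
  conv f g w = conv f' g w.
Proof.
  intros Hg; revert f f'; induction w as [|l w IH]; intros f f' H; simpl.
  - rewrite Hg; ring.
  - rewrite (H []) by (simpl; lia). f_equal. apply IH. intros v Hv; apply H; simpl; lia.
Qed.

Lemma conv_nil0_r f g w : conv f g w = (conv f (nil0 g) w + f w * g [])%fam.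
Proof.
  revert f; induction w as [|l w IH]; intros f; simpl; [ring|].
  rewrite (IH (fun v => f (l :: v))); ring.
Qed.

Lemma conv_nil0 f g w :
  w <> [] -> conv f g w = (f [] * g w + f w * g [] + conv (nil0 f) (nil0 g) w)%fam.
Proof.
  intros Hw; rewrite conv_nil0_r. destruct w as [|l w]; [easy|]. simpl.
  change (fun v => f (l :: v)) with (fun v => nil0 f (l :: v)). ring.
Qed.

Section birkhoff.
Variable wt : list T -> nat.

(** After multiplication by [eps^N], the negative powers of a Laurent series are the coefficients of
    index below [N]. *)
Definition trunc (N : nat) (f : fam) : fam :=
  fun x n => if Nat.ltb n N then f x n else 0.
Definition polar (N : nat) (f : fam) := forall x n, (N <= n)%nat -> f x n = 0.
Definition regular (N : nat) (f : fam) := forall x n, (n < N)%nat -> f x n = 0.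

Fixpoint bminus_aux (fuel : nat) f (w : list T) : fam :=
  match fuel with
  | O => f0
  | S n => (- trunc (wt w) (f w + conv (nil0 (bminus_aux n f)) (nil0 f) w))%fam
  end.

Definition bminus f w := bminus_aux (length w) f w.

Lemma bminus_aux_enough f n w :
  (length w <= n)%nat -> w <> [] -> bminus_aux n f w = bminus f w.
Proof.
  assert (H : forall n m w, (length w <= n)%nat -> (length w <= m)%nat -> w <> [] ->
             bminus_aux n f w = bminus_aux m f w).
  { clear n w. induction n as [|n IH]; intros m w Hn Hm Hw.
    - destruct w; simpl in *; [easy|lia].
    - destruct m as [|m]; [destruct w; simpl in *; [easy|lia]|].
      simpl. do 3 f_equal. apply conv_local; [reflexivity|].
      intros [|l v] Hv; [reflexivity|]. apply IH; try discriminate; lia. }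
  intros; apply H; auto.
Qed.

Lemma bminus_eq f w :
  w <> [] ->
  bminus f w = (- trunc (wt w) (f w + conv (nil0 (bminus f)) (nil0 f) w))%fam.
Proof.
  intros Hw; unfold bminus at 1. destruct w as [|l w]; [easy|].
  change (length (l :: w)) with (S (length w)); cbn [bminus_aux].
  do 3 f_equal. apply conv_local; [reflexivity|].
  intros [|l' v] Hv; [reflexivity|].
  apply bminus_aux_enough; try discriminate. simpl in *; lia.
Qed.

Lemma bminus_polar f w : polar (wt w) (bminus f w).
Proof.
  intros x n Hn. destruct w as [|l w]; [destruct n; reflexivity|].
  rewrite bminus_eq by discriminate.
  unfold fopp, sopp, trunc. destruct (Nat.ltb_spec n (wt (l :: w))); [lia|ring].
Qed.

(** By its recursion, [bminus f w] cancels exactly the coefficients below [wt w] of the remaining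
    terms of the convolution. *)
Lemma birkhoff_regular f w :
  f [] = f1 -> w <> [] -> regular (wt w) (conv (nil1 (bminus f)) f w).
Proof.
  intros Hf Hw x n Hn. rewrite conv_nil0, Hf by auto.
  replace (nil0 (nil1 (bminus f))) with (nil0 (bminus f))
    by (apply functional_extensionality; intros []; reflexivity).
  replace (nil1 (bminus f) w) with (bminus f w) by (destruct w; easy).
  rewrite bminus_eq at 1 by auto. simpl nil1.
  set (c := conv _ _ _). replace (f1 * f w + - trunc (wt w) (f w + c) * f1 + c)%fam
    with ((f w + c) + - trunc (wt w) (f w + c))%fam by ring.
  unfold fadd at 1, fopp, sadd, sopp, trunc.
  destruct (Nat.ltb_spec n (wt w)); [ring|lia].
Qed.

(** By induction on length the terms with proper prefixes are known; [g w] must cancel their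
    coefficients below [wt w] by regularity, and has no others by polarity. *)
Lemma birkhoff_unique f g :
  f [] = f1 -> g [] = f1 ->
  (forall w, w <> [] -> polar (wt w) (g w)) ->
  (forall w, w <> [] -> regular (wt w) (conv g f w)) ->
  forall w, w <> [] -> g w = bminus f w.
Proof.
  intros Hf Hg Hp Hr.
  assert (H : forall n w, (length w <= n)%nat -> w <> [] -> g w = bminus f w).
  { induction n as [|n IH]; intros w Hn Hw; [destruct w; simpl in *; [easy|lia]|].
    rewrite bminus_eq by auto.
    rewrite (conv_local _ (nil0 g)); [|reflexivity|].
    2:{ intros [|l v] Hv; [reflexivity|]. symmetry; apply IH; [lia|discriminate]. }
    pose proof (Hr w Hw) as R. rewrite conv_nil0, Hf, Hg in R by auto.
    apply fam_ext; intros x i. unfold fopp, sopp, trunc.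
    destruct (Nat.ltb_spec i (wt w)) as [Hi|Hi].
    - specialize (R x i Hi).
      replace (f1 * f w + g w * f1 + conv (nil0 g) (nil0 f) w)%fam
        with (g w + (f w + conv (nil0 g) (nil0 f) w))%fam in R by ring.
      unfold fadd at 1, sadd in R. lra.
    - rewrite (Hp w Hw x i Hi); ring. }
  intros w; apply (H (length w)); auto.
Qed.

Lemma polar_mul N M (f g : fam) : polar N f -> polar M g -> polar (N + M) (f * g)%fam.
Proof.
  intros Hf Hg x n Hn. unfold fmul. rewrite smul_rsum. apply rsum_zero. intros i Hi.
  destruct (Nat.le_gt_cases N i).
  - rewrite Hf by lia; ring.
  - rewrite Hg by lia; ring.
Qed.

Lemma polar_add N (f g : fam) : polar N f -> polar N g -> polar N (f + g)%fam.
Proof. intros Hf Hg x n Hn. unfold fadd, sadd. rewrite Hf, Hg by auto; ring. Qed.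

Lemma conv_polar f g :
  (forall u v, wt (u ++ v) = (wt u + wt v)%nat) ->
  f [] = f1 -> g [] = f1 ->
  (forall w, w <> [] -> polar (wt w) (f w)) ->
  (forall w, w <> [] -> polar (wt w) (g w)) ->
  forall w, w <> [] -> polar (wt w) (conv f g w).
Proof.
  intros Hwt Hf Hg Pf Pg w Hw.
  rewrite conv_nil0, Hf, Hg by auto.
  apply polar_add; [apply polar_add|].
  - replace (f1 * g w)%fam with (g w) by ring; auto.
  - replace (f w * f1)%fam with (f w) by ring; auto.
  (* The letters already passed are collected in a prefix [u]; being nonempty, it keeps the left
     factor polar of weight [wt u]. *)
  - assert (H : forall v u, u <> [] -> polar (wt (u ++ v)) (conv (fun w => f (u ++ w)) (nil0 g) v)).
    { induction v as [|l v IH]; intros u Hu; simpl.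
      - intros x n Hn. replace (f (u ++ []) * f0)%fam with f0 by ring. destruct n; reflexivity.
      - apply polar_add.
        + rewrite app_nil_r, Hwt. apply polar_mul; [auto|apply Pg; discriminate].
        + replace (u ++ l :: v) with ((u ++ [l]) ++ v) by (rewrite <- app_assoc; reflexivity).
          replace (fun v0 => f (u ++ l :: v0)) with (fun v0 => f ((u ++ [l]) ++ v0))
            by (apply functional_extensionality; intros; rewrite <- app_assoc; reflexivity).
          apply IH. destruct u; discriminate. }
    destruct w as [|l w]; [easy|]. simpl.
    intros x n Hn. specialize (H w [l] ltac:(discriminate) x n Hn). simpl in H.
    replace (f0 * g (l :: w) + conv (fun v => f (l :: v)) (nil0 g) w)%fam
      with (conv (fun v => f (l :: v)) (nil0 g) w) by ring. exact H.
Qed.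

(* Multiplying [f] on the left by a polar functional does not change its regular part. *)
Lemma birkhoff_twist c f w :
  (forall u v, wt (u ++ v) = (wt u + wt v)%nat) ->
  f [] = f1 -> c [] = f1 -> (forall w, w <> [] -> polar (wt w) (c w)) -> w <> [] ->
  forall x, (f w + conv (nil0 (bminus f)) (nil0 f) w)%fam x (wt w)
          = conv (nil1 (bminus (conv c f))) (conv c f) w x (wt w).
Proof.
  intros Hwt Hf Hc Pc Hw x.
  set (d := nil1 (bminus (conv c f))).
  assert (Hcf : conv c f [] = f1) by (simpl; rewrite Hf, Hc; ring).
  assert (Pd : forall w, w <> [] -> polar (wt w) (d w)).
  { intros [|l v] Hv; [easy|]. apply bminus_polar. }
  (* By associativity, [y] convolved with [f] is [d] convolved with [conv c f], which is regular;
     [y] is polar as a convolution of polar functionals, so uniqueness makes it the counterterm of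
     [f]. *)
  set (y := conv d c).
  assert (Hy : y [] = f1) by (unfold y; simpl; rewrite Hc; ring).
  assert (Py : forall w, w <> [] -> polar (wt w) (y w)) by (apply conv_polar; auto).
  assert (E : forall w, conv y f w = conv d (conv c f) w) by (intros; apply conv_assoc).
  assert (Uy : forall w, w <> [] -> y w = bminus f w).
  { apply birkhoff_unique; auto. intros v Hv. rewrite E. apply birkhoff_regular; auto. }
  rewrite <- E, (conv_nil0 y f w Hw), Hf, Hy by auto.
  rewrite (conv_local (nil0 (bminus f)) (nil0 y)); [|reflexivity|].
  2:{ intros [|l v] Hv; [reflexivity|]. symmetry; apply Uy; discriminate. }
  replace (f1 * f w + y w * f1 + conv (nil0 y) (nil0 f) w)%fam
    with (y w + (f w + conv (nil0 y) (nil0 f) w))%fam by ring.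
  (* The polar term [y w] has no coefficient of index [wt w]. *)
  unfold fadd at 2, sadd at 1. rewrite (Py w Hw x (wt w)) by lia.
  ring.
Qed.

End birkhoff.
End convolution.

Ltac real_eq := match goal with |- ?a = ?b => change (@eq R a b) end.

(** * Laurent expansions on the left of 0 *)

(** A Laurent expansion of pole order at most [N], tested only for negative [e], where the iterated
    sums converge. *)
Definition expands (f : R -> R) (N : nat) (a : series) : Prop :=
  exists rho, 0 < rho /\
    forall e, - rho < e < 0 -> is_pseries a e (e ^ N * f e).

Lemma is_pseries_radius (a : series) x l :
  is_pseries a x l -> Rbar_le (Rabs x) (CV_radius a).
Proof.
  intros H. apply is_pseries_R in H. apply Rbar_not_lt_le. intros Hlt.
  apply (CV_disk_outside a x Hlt). apply ex_series_lim_0. exists l; exact H.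
Qed.

Lemma expands_radius f N a :
  expands f N a -> exists rho, 0 < rho /\
    forall e, - rho < e < 0 ->
      is_pseries a e (e ^ N * f e) /\ Rbar_lt (Rabs e) (CV_radius a).
Proof.
  intros [rho [H0 H]]. exists rho; split; auto. intros e He; split; [auto|].
  (* The midpoint of [- rho] and [e] is farther from 0 than [e], so convergence there puts [e]
     strictly inside the disc. *)
  specialize (H ((e - rho) / 2) ltac:(lra)). apply is_pseries_radius in H.
  eapply Rbar_lt_le_trans; [|exact H]. simpl. rewrite !Rabs_left by lra. lra.
Qed.

Lemma expands_ext f g N a :
  (forall e, e < 0 -> f e = g e) -> expands f N a -> expands g N a.
Proof.
  intros E [rho [H0 H]]. exists rho; split; auto. intros e He.
  rewrite <- E by lra. auto.
Qed.

Lemma expands_const c : expands (fun _ => c) 0 (sconst c).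
Proof.
  exists 1; split; [lra|]. intros e He. apply is_pseries_R.
  apply (filterlim_ext (fun _ => e ^ 0 * c)); [|apply filterlim_const].
  intros n; induction n as [|n IH].
  - rewrite sum_O; simpl; ring.
  - rewrite sum_Sn, <- IH. simpl. unfold plus; simpl; ring.
Qed.

Lemma expands_add f g N a b :
  expands f N a -> expands g N b -> expands (fun e => f e + g e) N (sadd a b).
Proof.
  intros [r1 [P1 H1]] [r2 [P2 H2]]. exists (Rmin r1 r2).
  split; [apply Rmin_pos; auto|]. intros e He.
  pose proof (Rmin_l r1 r2); pose proof (Rmin_r r1 r2).
  rewrite Rmult_plus_distr_l.
  apply (is_pseries_plus a b e); [apply H1|apply H2]; lra.
Qed.

Lemma expands_mul f g N M a b :
  expands f N a -> expands g M b -> expands (fun e => f e * g e) (N + M) (smul a b).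
Proof.
  intros H1 H2. apply expands_radius in H1 as [r1 [P1 H1]].
  apply expands_radius in H2 as [r2 [P2 H2]]. exists (Rmin r1 r2).
  split; [apply Rmin_pos; auto|]. intros e He.
  pose proof (Rmin_l r1 r2); pose proof (Rmin_r r1 r2).
  destruct (H1 e ltac:(lra)) as [A1 B1]. destruct (H2 e ltac:(lra)) as [A2 B2].
  replace (e ^ (N + M) * (f e * g e)) with ((e ^ N * f e) * (e ^ M * g e))
    by (rewrite pow_add; ring).
  apply (is_pseries_ext (PS_mult a b)); [|apply is_pseries_mult; auto].
  intros n. rewrite smul_rsum. unfold PS_mult.
  generalize (fun i => a i * b (n - i)%nat). intros h.
  induction n as [|n IH]; simpl; [ring|]. rewrite IH. reflexivity.
Qed.

Lemma expands_eps f N a : expands f N a -> expands f (S N) (smul seps a).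
Proof.
  intros [rho [H0 H]]. exists rho; split; auto. intros e He.
  replace (e ^ S N * f e) with (scal e (e ^ N * f e))
    by (unfold scal; simpl; unfold mult; simpl; ring).
  apply (is_pseries_ext (PS_incr_1 a)); [|exact (is_pseries_incr_1 (V := R_NormedModule) a e _ (H e He))].
  intros [|n]; rewrite smul_eps; reflexivity.
Qed.

(** The sum is continuous at 0, so its value [a 0] there is the limit of zeros from the left. *)
Lemma pseries_left_zero_0 (a : series) rho :
  0 < rho -> (forall e, - rho < e < 0 -> is_pseries a e 0) -> a O = 0.
Proof.
  intros Hr H.
  assert (C : continuity_pt (PSeries a) 0).
  { apply PSeries_continuity. eapply Rbar_lt_le_trans;
      [|apply (is_pseries_radius a (- rho / 2) 0); apply H; lra].
    simpl. rewrite Rabs_R0. apply Rabs_pos_lt; lra. }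
  rewrite <- (PSeries_0 a).
  destruct (Req_dec (PSeries a 0) 0) as [E|E]; [exact E|exfalso].
  apply Rabs_pos_lt in E.
  destruct (C _ E) as [d [Hd Hc]].
  specialize (Hc (- Rmin d rho / 2)).
  assert (0 < Rmin d rho) by (apply Rmin_pos; auto).
  pose proof (Rmin_l d rho); pose proof (Rmin_r d rho).
  rewrite (is_pseries_unique a (- Rmin d rho / 2) 0) in Hc by (apply H; lra).
  assert (Hx : Rabs (0 - PSeries a 0) < Rabs (PSeries a 0)).
  { apply Hc. split; [split; [exact I|lra]|]. simpl. unfold Rdist.
    rewrite Rabs_left; lra. }
  replace (0 - PSeries a 0) with (- PSeries a 0) in Hx by ring.
  rewrite Rabs_Ropp in Hx. lra.
Qed.

(** With the constant term gone, the series can be divided by [e] and the argument repeated. *)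
Lemma pseries_left_zero (a : series) rho :
  0 < rho -> (forall e, - rho < e < 0 -> is_pseries a e 0) -> forall n, a n = 0.
Proof.
  intros Hr H n. revert a H. induction n as [|n IH]; intros a H;
    [eapply pseries_left_zero_0; eauto|].
  apply (IH (PS_decr_1 a)). intros e He.
  pose proof (is_pseries_decr_1 (V := R_NormedModule) a e (/ e) 0) as D.
  rewrite (pseries_left_zero_0 a rho Hr H) in D.
  replace 0 with (scal (/ e) (plus 0 (opp 0))).
  - apply D; [unfold mult, one; simpl; field; lra|apply H; auto].
  - unfold scal, plus, opp; simpl; unfold mult; simpl; ring.
Qed.

Lemma expands_unique f N a b : expands f N a -> expands f N b -> a = b.
Proof.
  intros [r1 [P1 H1]] [r2 [P2 H2]]. apply functional_extensionality; intros n.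
  apply Rminus_diag_uniq.
  apply (pseries_left_zero (PS_minus a b) (Rmin r1 r2)); [apply Rmin_pos; auto|].
  intros e He. pose proof (Rmin_l r1 r2); pose proof (Rmin_r r1 r2).
  replace 0 with (minus (e ^ N * f e) (e ^ N * f e))
    by (unfold minus, plus, opp; simpl; ring).
  apply (is_pseries_minus (V := R_NormedModule) a b e); [apply H1|apply H2]; lra.
Qed.

(** * The Laurent expansion of the generating function [e^y / (1 - e^y)] *)

(** Course-of-values recursion by fuel: when [F g n] depends only on [g] below [n], fuel [S n]
    suffices and the default [d] has no influence. *)
Fixpoint cov_aux {A} (d : A) (F : (nat -> A) -> nat -> A) (fuel n : nat) : A :=
  match fuel with O => d | S m => F (cov_aux d F m) n end.

Definition cov {A} (d : A) F n := cov_aux d F (S n) n.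

Lemma cov_eq {A} (d : A) F :
  (forall g g' n, (forall i, (i < n)%nat -> g i = g' i) -> F g n = F g' n) ->
  forall n, cov d F n = F (cov d F) n.
Proof.
  intros HF.
  assert (H : forall m n i, (i < m)%nat -> (i < n)%nat -> cov_aux d F m i = cov_aux d F n i).
  { induction m as [|m IH]; intros [|n] i Hm Hn; try lia. simpl.
    apply HF; intros j Hj; apply IH; lia. }
  intros n. unfold cov at 1. simpl. apply HF. intros i Hi. apply H; lia.
Qed.

(* Coefficients of [(e^(-y) - 1) / y]. *)
Definition dcoef : series := fun k => (-1) ^ S k / INR (fact (S k)).

(* Coefficients of the inverse [y / (e^(-y) - 1)]: up to sign [B_n / n!]. *)
Definition bern : series :=
  cov 0 (fun g n => match n with
                    | O => -1
                    | S m => rsum (fun k => g (m - k)%nat * dcoef (S k)) (S m)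
                    end).

Lemma bern_0 : bern O = -1.
Proof. reflexivity. Qed.

Lemma bern_S m : bern (S m) = rsum (fun k => bern (m - k)%nat * dcoef (S k)) (S m).
Proof.
  unfold bern at 1. rewrite cov_eq; [reflexivity|].
  intros g g' [|n] H; [reflexivity|]. apply rsum_ext; intros i Hi. rewrite H by lia; ring.
Qed.

Lemma bern_inverse : smul dcoef bern = sconst 1.
Proof.
  apply functional_extensionality; intros n. rewrite smul_rsum, rsum_shift.
  destruct n as [|n]; cbn [rsum Nat.sub]; [rewrite bern_0; unfold dcoef; simpl; field|].
  rewrite bern_S. cbn [rsum Nat.sub].
  rewrite (rsum_ext (fun i => dcoef (S i) * bern (n - i)%nat)
                    (fun k => bern (n - k)%nat * dcoef (S k))) by (intros; ring).
  simpl sconst. unfold dcoef at 1. simpl. field.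
Qed.

Lemma Rabs_dcoef k : Rabs (dcoef k) = / INR (fact (S k)).
Proof.
  unfold dcoef, Rdiv. rewrite Rabs_mult, pow_1_abs, Rmult_1_l.
  apply Rabs_pos_eq. left; apply Rinv_0_lt_compat, lt_0_INR, lt_O_fact.
Qed.

Lemma pow2_le_fact k : 2 ^ k <= INR (fact (S k)).
Proof.
  induction k as [|k IH]; [simpl; lra|].
  change (fact (S (S k))) with ((S (S k)) * fact (S k))%nat. rewrite mult_INR.
  simpl pow. apply Rmult_le_compat; try lra; [left; apply pow_lt; lra|].
  rewrite !S_INR. pose proof (pos_INR k); lra.
Qed.

Lemma Rabs_rsum f n : Rabs (rsum f n) <= rsum (fun i => Rabs (f i)) n.
Proof.
  induction n as [|n IH]; simpl; [rewrite Rabs_R0; lra|].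
  eapply Rle_trans; [apply Rabs_triang|]. lra.
Qed.

Lemma rsum_le f g n : (forall i, (i < n)%nat -> f i <= g i) -> rsum f n <= rsum g n.
Proof.
  induction n as [|n IH]; intros H; simpl; [lra|].
  apply Rplus_le_compat; auto with arith.
Qed.

(** The recursion bounds the next coefficient by the sum of [1 / (k + 2)!], hence of
    [1 / 2^(k + 1)], over [k >= 0], which is at most 1. This crude bound gives a radius of
    convergence of at least 1. *)
Lemma bern_bound n : Rabs (bern n) <= 1.
Proof.
  induction n as [n IH] using lt_wf_ind. destruct n as [|m].
  { rewrite bern_0, Rabs_left; lra. }
  rewrite bern_S. eapply Rle_trans; [apply Rabs_rsum|].
  eapply Rle_trans; [apply rsum_le with (g := fun k => / 2 ^ S k)|].
  - intros i Hi. rewrite Rabs_mult, Rabs_dcoef.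
    rewrite <- (Rmult_1_l (/ 2 ^ S i)). apply Rmult_le_compat; try apply Rabs_pos.
    + left; apply Rinv_0_lt_compat, lt_0_INR, lt_O_fact.
    + apply IH; lia.
    + apply Rinv_le_contravar; [apply pow_lt; lra|apply pow2_le_fact].
  - assert (H : forall n, rsum (fun k => / 2 ^ S k) n = 1 - / 2 ^ n).
    { induction n as [|n IHn]; cbn [rsum]; [simpl; field|].
      rewrite IHn. simpl pow. field. apply pow_nonzero; lra. }
    rewrite H. assert (0 < / 2 ^ S m) by (apply Rinv_0_lt_compat, pow_lt; lra). lra.
Qed.

Lemma bern_radius y : Rabs y < 1 -> Rbar_lt (Rabs y) (CV_radius bern).
Proof.
  intros Hy. apply Rbar_lt_le_trans with 1; [exact Hy|].
  apply (proj1 (CV_radius_bounded bern)). exists 1. intros n.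
  rewrite pow1, Rmult_1_r. apply bern_bound.
Qed.

(** For [y < 0] this is [e^y / (1 - e^y)], the sum of [e^(n y)] over [n >= 1]. *)
Definition Qf (y : R) : R := / (exp (- y) - 1).

Lemma Qf_denom y : y < 0 -> 0 < exp (- y) - 1.
Proof. intros Hy. pose proof (exp_ineq1 (- y)). lra. Qed.

Lemma is_pseries_dcoef y : y <> 0 -> is_pseries dcoef y ((exp (- y) - 1) / y).
Proof.
  intros Hy.
  set (a := fun n => (-1) ^ n / INR (fact n)).
  assert (Ha : is_pseries a y (exp (- y))).
  { apply is_pseries_R. pose proof (is_exp_Reals (- y)) as H. apply is_pseries_R in H.
    apply (is_series_ext (fun n => / INR (fact n) * (- y) ^ n)); [|exact H].
    intros n. unfold a. replace (- y) with (-1 * y) by ring. rewrite Rpow_mult_distr.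
    real_eq; unfold Rdiv; ring. }
  pose proof (is_pseries_decr_1 (V := R_NormedModule) a y (/ y) _ ltac:(unfold mult, one; simpl; field; auto) Ha) as D.
  replace ((exp (- y) - 1) / y) with (scal (/ y) (plus (exp (- y)) (opp (a O)))).
  - exact D.
  - unfold a, scal, plus, opp; simpl; unfold mult; simpl. field; auto.
Qed.

(** The product with the series of [(e^(-y) - 1) / y] is 1 coefficientwise, hence also for the
    values inside both discs. *)
Lemma is_pseries_bern y : - 1 < y < 0 -> is_pseries bern y (y * Qf y).
Proof.
  intros Hy.
  assert (Hr : Rabs y < 1) by (rewrite Rabs_left; lra).
  pose proof (PSeries_correct _ _ (CV_radius_inside _ _ (bern_radius y Hr))) as Hb.
  assert (Hd := is_pseries_dcoef y ltac:(lra)).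
  assert (Rd : Rbar_lt (Rabs y) (CV_radius dcoef)).
  { eapply Rbar_lt_le_trans; [|apply (is_pseries_radius dcoef 1 _ (is_pseries_dcoef 1 ltac:(lra)))].
    rewrite Rabs_R1; exact Hr. }
  pose proof (is_pseries_mult _ _ _ _ _ Hd Hb Rd (bern_radius y Hr)) as H.
  apply is_pseries_unique in H.
  rewrite (PSeries_ext _ (sconst 1)) in H.
  2:{ intros n. rewrite <- bern_inverse, smul_rsum. unfold PS_mult.
      generalize (fun i => dcoef i * bern (n - i)%nat). intros h.
      induction n as [|n IH]; simpl; [ring|]. rewrite IH; reflexivity. }
  rewrite (is_pseries_unique (sconst 1) y 1) in H.
  2:{ apply is_pseries_R. apply (filterlim_ext (fun _ => 1)); [|apply filterlim_const].
      intros n; induction n as [|n IH]; [rewrite sum_O; simpl; ring|].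
      rewrite sum_Sn, <- IH. unfold plus; simpl; ring. }
  pose proof (Qf_denom y ltac:(lra)).
  replace (y * Qf y) with (PSeries bern y); [exact Hb|].
  unfold Qf. apply Rmult_eq_reg_l with ((exp (- y) - 1) / y).
  - rewrite <- H. field. lra.
  - apply Rmult_integral_contrapositive_currified; [lra|apply Rinv_neq_0_compat; lra].
Qed.

(** The expansion of [eps * Q (eps * v)]. Its only coefficient singular at [v = 0] has index 0 and
    equals [- / v], because [bern 0 = -1]. *)
Definition qser (v : R) : series :=
  fun n => match n with O => - / v | S m => bern n * v ^ m end.

Lemma expands_qser v : 0 < v -> expands (fun e => Qf (e * v)) 1 (qser v).
Proof.
  intros Hv. exists (/ v). split; [apply Rinv_0_lt_compat; auto|]. intros e He.
  apply is_pseries_R.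
  assert (Hy : - 1 < e * v < 0).
  { split; [|nra]. apply Rmult_lt_reg_r with (/ v); [apply Rinv_0_lt_compat; auto|].
    field_simplify; [|lra|lra]. replace (-1 / v) with (- / v) by (field; lra). lra. }
  pose proof (is_pseries_bern _ Hy) as H. apply is_pseries_R in H.
  apply (is_series_scal (/ v)) in H.
  replace (e ^ 1 * Qf (e * v)) with (scal (/ v) (e * v * Qf (e * v))).
  2:{ unfold scal; simpl; unfold mult; simpl. field; lra. }
  eapply is_series_ext; [|exact H]. intros [|n].
  - unfold scal; simpl; unfold mult; simpl. rewrite bern_0. field; lra.
  - unfold scal; simpl; unfold mult; simpl. rewrite Rpow_mult_distr. field; lra.
Qed.

Lemma Qf_mul a b :
  a < 0 -> b < 0 -> Qf a * Qf b = Qf (a + b) * (1 + Qf a + Qf b).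
Proof.
  intros Ha Hb. unfold Qf. replace (- (a + b)) with (- a + - b) by ring.
  rewrite exp_plus. pose proof (Qf_denom a Ha). pose proof (Qf_denom b Hb).
  field. split; [lra|split; [lra|]]. nra.
Qed.

(** Both sides expand the same function, by the functional equation of Q. The summand [seps] is the
    1 in [1 + Q + Q], multiplied by eps. *)
Lemma qser_mul a b :
  0 < a -> 0 < b ->
  smul (qser a) (qser b)
  = smul (qser (a + b)) (sadd (sadd seps (qser a)) (qser b)).
Proof.
  intros Ha Hb.
  apply (expands_unique (fun e => Qf (e * a) * Qf (e * b)) (1 + 1)).
  - apply expands_mul; apply expands_qser; auto.
  - apply (expands_ext (fun e => Qf (e * (a + b)) * (1 + Qf (e * a) + Qf (e * b)))).
    + intros e He. rewrite (Rmult_plus_distr_l e). symmetry; apply Qf_mul; nra.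
    + apply expands_mul; [apply expands_qser; lra|].
      apply (expands_add (fun e => 1 + Qf (e * a))); [|apply expands_qser; auto].
      apply (expands_add (fun _ => 1)); [|apply expands_qser; auto].
      replace seps with (smul seps (sconst 1)) by ring.
      apply expands_eps, expands_const.
Qed.

(** * The unrenormalised functional on words *)

Definition vadd (v w : V) : V := fun x => v x + w x.
Definition vzero : V := fun _ => 0.
Definition vinv (v : V) : V := fun x => / v x.
Definition Vpos (v : V) := forall x, 0 < v x.

Lemma vadd_comm v w : vadd v w = vadd w v.
Proof. apply functional_extensionality; intros x; unfold vadd; ring. Qed.
Lemma vadd_assoc u v w : vadd (vadd u v) w = vadd u (vadd v w).
Proof. apply functional_extensionality; intros x; unfold vadd; ring. Qed.
Lemma vadd_0_l v : vadd vzero v = v.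
Proof. apply functional_extensionality; intros x; unfold vadd, vzero; ring. Qed.
Lemma Vpos_add v w : Vpos v -> Vpos w -> Vpos (vadd v w).
Proof. intros H1 H2 x; specialize (H1 x); specialize (H2 x); unfold vadd; lra. Qed.

(* [qf v] is [eps * Q (eps * v)] with [Q y = e^y / (1 - e^y)]. *)
Definition qf (v : V) : fam := fun x => qser (v x).

Lemma qf_mul v w :
  Vpos v -> Vpos w -> (qf v * qf w = qf (vadd v w) * (feps + qf v + qf w))%fam.
Proof. intros Hv Hw. apply functional_extensionality; intros x. apply qser_mul; auto. Qed.

(* [mom i v] is [eps^(i+1) * sum_(n >= 1) n^i e^(n * eps * v)]. *)
Definition mom (i : nat) (v : V) : fam :=
  cov f0 (fun g i => qf v * (fpow feps i
     + Sum (seq 0 i) (fun k => fconst (fun _ => Binomial.C i k) * fpow feps (i - 1 - k) * g k)))%fam i.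

Lemma mom_eq i v :
  mom i v = (qf v * (fpow feps i
     + Sum (seq 0 i) (fun k => fconst (fun _ => Binomial.C i k) * fpow feps (i - 1 - k) * mom k v)))%fam.
Proof.
  unfold mom at 1. rewrite cov_eq; [reflexivity|].
  intros g g' n H. do 2 f_equal. apply Sum_ext_in. intros k Hk. apply in_seq in Hk.
  rewrite H by lia. reflexivity.
Qed.

Lemma mom_0 v : mom 0 v = qf v.
Proof. rewrite mom_eq; simpl; ring. Qed.

(* A letter [(a, v)] stands for [s = - a] and for a parameter [r = v x]. *)
Definition letter := (nat * V)%type.
Definition zlet (v : V) : letter := (O, v).

Fixpoint wt (w : list letter) : nat :=
  match w with nil => O | l :: w' => S (fst l + wt w') end.

Lemma wt_app u v : wt (u ++ v) = (wt u + wt v)%nat.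
Proof. induction u as [|l u IH]; simpl; [reflexivity|rewrite IH; lia]. Qed.

(** With the largest index written as [m + n], [n] being the next one, the binomial theorem sends
    [m^i] to a moment and [n^(a - i)] to the next letter; the exponential [e^(n eps v)] merges with
    that of the next letter, so the parameters accumulate. *)
Fixpoint phi1 (w : list letter) (a : nat) (v : V) : fam :=
  match w with
  | nil => mom a v
  | (b, u) :: w' =>
      Sum (seq 0 (S a)) (fun i =>
        fconst (fun _ => Binomial.C a i) * mom i v * phi1 w' (b + (a - i)) (vadd v u))%fam
  end.

(* [phi w] is [eps^(wt w) * Z(w; eps)]. *)
Definition phi (w : list letter) : fam :=
  match w with nil => f1 | (a, v) :: w' => phi1 w' a v end.

Lemma phi1_zero b u w v : (phi1 ((b, u) :: w) 0 v = qf v * phi1 w b (vadd v u))%fam.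
Proof.
  simpl. rewrite mom_0, Nat.add_0_r.
  replace (fconst (fun _ : X => Binomial.C 0 0)) with f1; [ring|].
  unfold f1, fconst. rewrite C_n_0. reflexivity.
Qed.

(** On zero letters the iterated sum factorises over the partial sums of the parameters; [G],
    evaluated at the total, stands for whatever follows. *)
Fixpoint Phi (r : V) (u : list V) (G : V -> fam) : fam :=
  match u with
  | nil => G r
  | c :: u' => (qf (vadd r c) * Phi (vadd r c) u' G)%fam
  end.

Lemma phi1_zeros u a c w v :
  phi1 (map zlet u ++ (a, c) :: w) 0 v
  = (qf v * Phi v u (fun r => phi1 w a (vadd r c)))%fam.
Proof.
  revert v; induction u as [|c' u IH]; intros v; cbn [map app].
  - apply phi1_zero.
  - unfold zlet at 1. rewrite phi1_zero, IH. reflexivity.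
Qed.

Lemma phi1_zeros_nil u v :
  phi1 (map zlet u) 0 v = (qf v * Phi v u (fun _ => f1))%fam.
Proof.
  revert v; induction u as [|c' u IH]; intros v; cbn [map].
  - simpl. rewrite mom_0; ring.
  - unfold zlet at 1. rewrite phi1_zero, IH. reflexivity.
Qed.

Lemma phi_zeros u a c w :
  phi (map zlet u ++ (a, c) :: w) = Phi vzero u (fun r => phi1 w a (vadd r c)).
Proof.
  destruct u as [|c' u]; simpl; rewrite vadd_0_l; [reflexivity|apply phi1_zeros].
Qed.

Lemma phi_zeros_nil u : phi (map zlet u) = Phi vzero u (fun _ => f1).
Proof.
  destruct u as [|c' u]; [reflexivity|]. simpl; rewrite vadd_0_l. apply phi1_zeros_nil.
Qed.

(** * Quasi-shuffling one zero letter into a block of zero letters *)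

(** The diagonal terms of the quasi-shuffle of [b] with a word: each identifies two summation
    indices, which lowers the weight by one and explains the accompanying factor [feps]. *)
Fixpoint bumps (b : V) (S : list V) : list (list V) :=
  match S with
  | nil => nil
  | c :: S' => (vadd b c :: S') :: map (cons c) (bumps b S')
  end.

Lemma Sum_bumps_cons b c S (h : list V -> fam) :
  Sum (bumps b (c :: S)) h = (h (vadd b c :: S) + Sum (bumps b S) (fun w => h (c :: w)))%fam.
Proof. simpl. rewrite Sum_map. reflexivity. Qed.

Lemma bumps_length b S S' : In S' (bumps b S) -> length S' = length S.
Proof.
  revert S'; induction S as [|c S IH]; simpl; intros S' H; [easy|].
  destruct H as [<-|H]; [reflexivity|].
  apply in_map_iff in H as [w [<- H]]. simpl. rewrite (IH w H); reflexivity.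
Qed.

Lemma bumps_forall (P : V -> Prop) b S S' :
  (forall v, P v -> P (vadd b v)) -> List.Forall P S -> In S' (bumps b S) -> List.Forall P S'.
Proof.
  intros Hb; revert S'; induction S as [|c S IH]; simpl; intros S' HS H; [easy|].
  inversion HS; subst. destruct H as [<-|H]; [constructor; auto|].
  apply in_map_iff in H as [w [<- H]]. constructor; auto.
Qed.

Lemma Phi_end r u G :
  Phi r u G = (Phi r u (fun _ => f1) * G (fold_left vadd u r))%fam.
Proof.
  revert r; induction u as [|c u IH]; intros r; simpl; [ring|rewrite IH; ring].
Qed.

(* Here [r] is the sum of the letters to the left; the two sides are written without dividing
   by [qf r]. *)
Lemma Phi_quasi_shuffle_aux r b u G :
  Vpos r -> Vpos b -> List.Forall Vpos u ->
  (qf r * (Sum (ins b u) (fun w => Phi r w G) + feps * Sum (bumps b u) (fun w => Phi r w G))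
   = qf b * qf r * Phi r u (fun t => G (vadd t b))
     - (feps + qf b) * qf (vadd r b) * Phi (vadd r b) u G)%fam.
Proof.
  intros Hr Hb Hu; revert r Hr; induction u as [|c u IH]; intros r Hr.
  - simpl. pose proof (qf_mul r b Hr Hb) as E.
    replace (qf b * qf r)%fam with (qf r * qf b)%fam by ring. rewrite E. ring.
  - inversion Hu as [|? ? Hc Hu']; subst.
    rewrite Sum_ins_cons, Sum_bumps_cons. cbn [Phi].
    rewrite !Sum_mul_l.
    specialize (IH Hu' (vadd r c) (Vpos_add _ _ Hr Hc)).
    rewrite (vadd_comm b c), <- !vadd_assoc.
    rewrite (vadd_assoc r b c), (vadd_comm b c), <- (vadd_assoc r c b).
    set (L1 := Sum (ins b u) _) in *. set (L2 := Sum (bumps b u) _) in *.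
    set (A := Phi (vadd r c) u _) in *. set (B := Phi (vadd (vadd r c) b) u G) in *.
    set (q1 := qf (vadd r c)) in *. set (q2 := qf (vadd (vadd r c) b)) in *.
    pose proof (qf_mul r b Hr Hb) as E. set (q3 := qf (vadd r b)) in *.
    transitivity (qf r * (q3 * (q2 * B) + feps * (q2 * B)) + qf r * (q1 * (L1 + feps * L2)))%fam;
      [ring|].
    rewrite IH.
    transitivity ((qf r * q3 - qf r * qf b) * (q2 * B) + qf b * qf r * (q1 * A))%fam; [ring|].
    rewrite E. ring.
Qed.

(** With no letter to the left there is no factor [qf r]. Peeling off the first letter [c] provides
    one, and the boundary term of the general identity at [r = c] cancels the words in which [b]
    precedes [c] or is added to it. *)
Lemma Phi_quasi_shuffle b u G :
  Vpos b -> List.Forall Vpos u ->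
  (Sum (ins b u) (fun w => Phi vzero w G) + feps * Sum (bumps b u) (fun w => Phi vzero w G)
   = qf b * Phi vzero u (fun t => G (vadd t b)))%fam.
Proof.
  intros Hb Hu. destruct u as [|c u].
  - simpl. rewrite !vadd_0_l. ring.
  - inversion Hu as [|? ? Hc Hu']; subst.
    rewrite Sum_ins_cons, Sum_bumps_cons. cbn [Phi]. rewrite !vadd_0_l, !Sum_mul_l.
    pose proof (Phi_quasi_shuffle_aux c b u G Hc Hb Hu') as E.
    set (L1 := Sum (ins b u) _) in *. set (L2 := Sum (bumps b u) _) in *.
    rewrite (vadd_comm b c).
    transitivity ((feps + qf b) * (qf (vadd c b) * Phi (vadd c b) u G)
                  + qf c * (L1 + feps * L2))%fam; [ring|].
    rewrite E. ring.
Qed.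

(** After [c] has been inserted, [b] is added either to [c], which amounts to inserting [b + c], or
    to a letter of [u]. *)
Lemma Sum_bumps_ins b c u (h : list V -> fam) :
  Sum (ins c u) (fun w => Sum (bumps b w) h)
  = (Sum (ins (vadd b c) u) h + Sum (bumps b u) (fun w => Sum (ins c w) h))%fam.
Proof.
  revert h; induction u as [|d u IH]; intros h; [simpl; ring|].
  rewrite !Sum_ins_cons, Sum_bumps_cons.
  rewrite (Sum_ext (ins c u) _ (fun w => h (vadd b d :: w)
             + Sum (bumps b w) (fun w => h (d :: w)))%fam)
    by (intros w; apply Sum_bumps_cons).
  rewrite Sum_add, IH, !Sum_bumps_cons, Sum_ins_cons.
  rewrite (Sum_ext (bumps b u) (fun w => Sum (ins c (d :: w)) h)
             (fun w => h (c :: d :: w) + Sum (ins c w) (fun w => h (d :: w)))%fam)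
    by (intros w; apply Sum_ins_cons).
  rewrite Sum_add. ring.
Qed.

Lemma Sum_perms_bumps b S (h : list V -> fam) :
  Sum (perms S) (fun u => Sum (bumps b u) h)
  = Sum (bumps b S) (fun S' => Sum (perms S') h).
Proof.
  revert h; induction S as [|c S IH]; intros h; [simpl; ring|].
  rewrite Sum_perms_cons, Sum_bumps_cons, Sum_perms_cons.
  rewrite (Sum_ext _ _ _ (fun u => Sum_bumps_ins b c u h)), Sum_add, IH.
  f_equal. apply Sum_ext; intros w. rewrite Sum_perms_cons. reflexivity.
Qed.

Definition blockF (S : list V) (G : V -> fam) : fam := Sum (perms S) (fun u => Phi vzero u G).

Lemma Forall_perm {T} (P : T -> Prop) (l l' : list T) :
  Permutation l l' -> List.Forall P l -> List.Forall P l'.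
Proof. intros Hp H. rewrite <- Hp; exact H. Qed.

Lemma blockF_cons b S G :
  Vpos b -> List.Forall Vpos S ->
  (blockF (b :: S) G
   = qf b * blockF S (fun t => G (vadd t b)) - feps * Sum (bumps b S) (fun S' => blockF S' G))%fam.
Proof.
  intros Hb HS. unfold blockF. rewrite Sum_perms_cons, <- Sum_perms_bumps, <- !Sum_mul_l.
  rewrite (Sum_ext_in (perms S) (fun a => qf b * _)%fam
    (fun u => Sum (ins b u) (fun w => Phi vzero w G)
              + feps * Sum (bumps b u) (fun w => Phi vzero w G))%fam).
  - rewrite Sum_add. ring.
  - intros u Hu. symmetry. apply Phi_quasi_shuffle; auto.
    apply (Forall_perm _ S); auto. apply perms_perm; auto.
Qed.

(** * The polar counterterm on zero letters *)

(** The recursion is not structural because of the altered tails; these keep their length, which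
    therefore serves as fuel. *)
Fixpoint cs_aux (n : nat) (S : list V) : fam :=
  match n, S with
  | O, _ | _, nil => f1
  | Datatypes.S m, b :: S' =>
      (fconst (vinv b) * cs_aux m S' - feps * Sum (bumps b S') (cs_aux m))%fam
  end.

(* Satisfies the recursion of [blockF] with [qf b] replaced by minus its polar part, [1 / b]. *)
Definition cs (S : list V) : fam := cs_aux (length S) S.

Lemma cs_cons b S :
  cs (b :: S) = (fconst (vinv b) * cs S - feps * Sum (bumps b S) cs)%fam.
Proof.
  unfold cs at 1; simpl. do 2 f_equal. apply Sum_ext_in. intros w Hw. unfold cs.
  rewrite (bumps_length b S w Hw). reflexivity.
Qed.

Lemma Sum_bumps_bumps b c S (h : list V -> fam) :
  Sum (bumps b S) (fun w => Sum (bumps c w) h) = Sum (bumps c S) (fun w => Sum (bumps b w) h).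
Proof.
  revert h; induction S as [|d S IH]; intros h; [reflexivity|].
  rewrite !Sum_bumps_cons.
  rewrite (Sum_ext (bumps b S) (fun w => Sum (bumps c (d :: w)) h)
     (fun w => h (vadd c d :: w) + Sum (bumps c w) (fun w => h (d :: w)))%fam)
    by (intros; apply Sum_bumps_cons).
  rewrite (Sum_ext (bumps c S) (fun w => Sum (bumps b (d :: w)) h)
     (fun w => h (vadd b d :: w) + Sum (bumps b w) (fun w => h (d :: w)))%fam)
    by (intros; apply Sum_bumps_cons).
  rewrite !Sum_add, IH.
  rewrite <- (vadd_assoc c b d), (vadd_comm c b), vadd_assoc. ring.
Qed.

Lemma Sum_bumps_perm b S S' (h : list V -> fam) :
  (forall w w', length w = length S -> Permutation w w' -> h w = h w') ->
  Permutation S S' -> Sum (bumps b S) h = Sum (bumps b S') h.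
Proof.
  intros Hh HP; revert h Hh; induction HP as [|c l l' HP IH|c d l|l l' l'' H1 IH1 H2 IH2];
    intros h Hh.
  - reflexivity.
  - rewrite !Sum_bumps_cons. rewrite (Hh (vadd b c :: l) (vadd b c :: l')); auto.
    f_equal. apply IH. intros w w' Hw HP'. apply Hh; [simpl; lia|auto].
  - rewrite !Sum_bumps_cons.
    rewrite (Hh (vadd b d :: c :: l) (c :: vadd b d :: l)) by (auto; constructor).
    rewrite (Hh (d :: vadd b c :: l) (vadd b c :: d :: l)) by (auto; constructor).
    rewrite (Sum_ext_in (bumps b l) (fun w => h (d :: c :: w)) (fun w => h (c :: d :: w))).
    + ring.
    + intros w Hw. apply Hh; [simpl; rewrite (bumps_length _ _ _ Hw); reflexivity|constructor].
  - rewrite IH1, IH2; auto. intros w w' Hw. apply Hh.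
    rewrite Hw. symmetry; apply Permutation_length; auto.
Qed.

(** The recursion singles out the first letter, but unfolding it twice on [c :: d :: l] gives an
    expression symmetric in [c] and [d], since additions of [c] and of [d] to letters of [l]
    commute. *)
Lemma cs_perm S S' : Permutation S S' -> cs S = cs S'.
Proof.
  assert (H : forall n S S', (length S <= n)%nat -> Permutation S S' -> cs S = cs S').
  { clear S S'. induction n as [|n IH]; intros S S' Hn HP.
    - destruct S; [|simpl in Hn; lia]. apply Permutation_nil in HP as ->. reflexivity.
    - revert Hn; induction HP as [|c l l' HP IH1|c d l|l l' l'' H1 IH1 H2 IH2]; intros Hn.
      + reflexivity.
      + simpl in Hn. rewrite !cs_cons, IH1 by lia. do 2 f_equal.
        apply Sum_bumps_perm; auto. intros w w' Hw. apply IH; lia.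
      + rewrite !cs_cons, !Sum_bumps_cons.
        rewrite (Sum_ext (bumps c l) (fun w => cs (d :: w)) _ (fun w => cs_cons d w)).
        rewrite (Sum_ext (bumps d l) (fun w => cs (c :: w)) _ (fun w => cs_cons c w)).
        rewrite (vadd_comm d c).
        assert (E : forall u (g h : list V -> fam) l,
          Sum l (fun w => fconst u * g w - feps * h w)%fam
          = (fconst u * Sum l g - feps * Sum l h)%fam).
        { intros u g h l0. induction l0 as [|w l0 IHl]; simpl; [ring|rewrite IHl; ring]. }
        rewrite !E, (Sum_bumps_bumps c d). ring.
      + rewrite IH1, IH2; auto. rewrite <- (Permutation_length H1); auto. }
  intros HP; apply (H (length S)); auto.
Qed.

Lemma polar_eps N f : polar N f -> polar (S N) (feps * f)%fam.
Proof.
  intros H x [|n] Hn; [lia|]. unfold fmul, feps. rewrite smul_eps. apply H; lia.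
Qed.

Lemma polar_const N v f : polar N f -> polar N (fconst v * f)%fam.
Proof.
  intros H x n Hn. unfold fmul, fconst. rewrite smul_rsum, rsum_shift.
  rewrite Nat.sub_0_r, H by lia. rewrite rsum_zero; [ring|]. intros i Hi; simpl; ring.
Qed.

Lemma polar_weaken N M f : (N <= M)%nat -> polar N f -> polar M f.
Proof. intros HN H x n Hn; apply H; lia. Qed.

Lemma polar_opp N f : polar N f -> polar N (- f)%fam.
Proof. intros H x n Hn. unfold fopp, sopp; rewrite H by auto; ring. Qed.

Lemma polar_Sum {T} N (l : list T) f : (forall a, In a l -> polar N (f a)) -> polar N (Sum l f).
Proof.
  induction l as [|a l IH]; intros H; simpl; [intros x [|n] Hn; reflexivity|].
  apply polar_add; auto with datatypes.
Qed.

(** Each letter contributes a constant or one factor eps, and the last remaining letter only a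
    constant, so the degree in eps stays below the number of letters. *)
Lemma cs_polar S : S <> [] -> polar (length S) (cs S).
Proof.
  assert (H : forall n S, (length S <= n)%nat -> S <> [] -> polar (length S) (cs S)).
  { clear S. induction n as [|n IH]; intros [|b S] Hn HS; try easy; simpl in Hn.
    rewrite cs_cons.
    replace (fconst (vinv b) * cs S - feps * Sum (bumps b S) cs)%fam
      with (fconst (vinv b) * cs S + - (feps * Sum (bumps b S) cs))%fam by ring.
    apply polar_add.
    - apply polar_const. destruct S as [|c S].
      + intros x [|m] Hm; simpl in *; [lia|reflexivity].
      + eapply polar_weaken; [|apply IH; [lia|discriminate]]. simpl; lia.
    - apply polar_opp, (polar_eps (length S)), polar_Sum. intros w Hw.
      rewrite <- (bumps_length _ _ _ Hw). apply IH; [rewrite (bumps_length _ _ _ Hw); lia|].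
      intros ->. destruct S; [easy|]. apply bumps_length in Hw. discriminate. }
  apply (H (length S)); auto.
Qed.

Definition is_zero (l : letter) : bool := Nat.eqb (fst l) 0.

(* A functional on words whose symmetrisation over a zero block is [cs]. *)
Definition counter (w : list letter) : fam :=
  if forallb is_zero w
  then (fconst (fun _ => / INR (fact (length w))) * cs (map snd w))%fam
  else f0.

Lemma counter_nil : counter [] = f1.
Proof.
  unfold counter; simpl. unfold cs; simpl.
  replace (fconst (fun _ => / 1)) with f1; [ring|].
  unfold f1, fconst. rewrite Rinv_1. reflexivity.
Qed.

Lemma counter_polar w : w <> [] -> polar (wt w) (counter w).
Proof.
  intros Hw. unfold counter. destruct (forallb is_zero w) eqn:E.
  - apply polar_const. replace (wt w) with (length (map snd w)).
    + apply cs_polar. destruct w; [easy|discriminate].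
    + clear Hw. induction w as [|l w IH]; [reflexivity|]. simpl in *.
      apply andb_prop in E as [E1 E2]. apply Nat.eqb_eq in E1. rewrite IH by auto. lia.
  - intros x [|n] Hn; reflexivity.
Qed.

Lemma perms_map {T U} (f : T -> U) S : perms (map f S) = map (map f) (perms S).
Proof.
  assert (HI : forall b u, ins (f b) (map f u) = map (map f) (ins b u)).
  { intros b u; induction u as [|c u IH]; simpl; [reflexivity|].
    rewrite IH, !map_map. reflexivity. }
  induction S as [|b S IH]; simpl; [reflexivity|].
  rewrite IH. clear IH. induction (perms S) as [|u l IH]; simpl; [reflexivity|].
  rewrite IH, HI, map_app. reflexivity.
Qed.

Lemma ins_length {T} (b : T) u : length (ins b u) = S (length u).
Proof. induction u as [|c u IH]; simpl; [reflexivity|rewrite length_map, IH; reflexivity]. Qed.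

Lemma perms_length {T} (S : list T) : length (perms S) = fact (length S).
Proof.
  induction S as [|b S IH]; [reflexivity|]. cbn [length fact perms].
  assert (H : forall l, (forall u, In u l -> length u = length S) ->
            length (flat_map (ins b) l) = (Datatypes.S (length S) * length l)%nat).
  { induction l as [|u l IHl]; intros H; simpl; [lia|].
    rewrite length_app, ins_length, H, IHl by auto with datatypes. lia. }
  rewrite H, IH; [reflexivity|].
  intros u Hu. symmetry. apply Permutation_length, perms_perm; auto.
Qed.

Lemma Sum_const {T} (l : list T) c :
  Sum l (fun _ => c) = (fconst (fun _ => INR (length l)) * c)%fam.
Proof.
  induction l as [|a l IH].
  - simpl. change (fconst (fun _ => 0)) with f0. ring.
  - cbn [Sum length]. rewrite IH.
    replace (fconst (fun _ => INR (S (length l)))) with (f1 + fconst (fun _ => INR (length l)))%fam;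
      [ring|].
    apply fam_ext; intros x [|n]; unfold fadd, sadd, f1, fconst; simpl;
      [destruct (length l); simpl; ring|ring].
Qed.

Lemma fconst_mul v w : (fconst v * fconst w)%fam = fconst (fun x => v x * w x).
Proof.
  apply fam_ext; intros x n. unfold fmul, fconst, smul.
  destruct n as [|n]; simpl; [reflexivity|].
  change (stail (sconst (v x))) with (fun _ : nat => 0). rewrite cauchy_0_l; ring.
Qed.

(** As [cs] is symmetric, all rearrangements contribute equally, and the inverse factorial in
    [counter] compensates for their number. *)
Lemma Sum_counter S : Sum (perms (map zlet S)) counter = cs S.
Proof.
  rewrite perms_map, Sum_map.
  rewrite (Sum_ext_in _ _ (fun _ => fconst (fun _ => / INR (fact (length S))) * cs S)%fam).
  - rewrite Sum_const, perms_length.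
    transitivity (fconst (fun _ => INR (fact (length S))) * fconst (fun _ => / INR (fact (length S)))
                  * cs S)%fam; [ring|].
    rewrite fconst_mul.
    replace (fconst _) with f1; [ring|]. unfold f1, fconst.
    rewrite Rinv_r by (apply INR_fact_neq_0). reflexivity.
  - intros u Hu. apply perms_perm in Hu. unfold counter.
    replace (forallb is_zero (map zlet u)) with true.
    + rewrite length_map, map_map, map_id, (Permutation_length Hu). f_equal.
      apply cs_perm. symmetry; auto.
    + symmetry. apply forallb_forall. intros l Hl. apply in_map_iff in Hl as [v [<- _]].
      reflexivity.
Qed.

(** * The symmetrised functional with the counterterm *)

Definition psi : list letter -> fam := conv counter phi.

(** The symmetrised value of [psi] on a zero block [S] with continuation [G]: the letters are
    distributed between counterterm and iterated sum. *)
Definition blockH (S : list V) (G : V -> fam) : fam :=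
  Sum (splits S) (fun p => cs (fst p) * blockF (snd p) G)%fam.

(** The continuation of a leading block whose letters add up to [r]; the sum [r] is absorbed into
    the parameter of the next letter. *)
Definition tailG (q : list (letter * list letter)) (r : V) : fam :=
  match q with
  | nil => f1
  | ((a, c), B) :: q' => Sum (words (B, q')) (fun v => phi1 v a (vadd r c))
  end.

Lemma Sum_words_phi U q : Sum (words (map zlet U, q)) phi = blockF U (tailG q).
Proof.
  rewrite Sum_words, perms_map, Sum_map. apply Sum_ext; intros u.
  destruct q as [|[[a c] S] q].
  - simpl. rewrite app_nil_r, phi_zeros_nil. unfold tailG. ring.
  - rewrite Sum_qwords_cons.
    rewrite (Sum_ext _ _ _ (fun v => phi_zeros u a c v)).
    rewrite (Phi_end vzero u (tailG _)). unfold tailG. rewrite <- Sum_mul_l.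
    apply Sum_ext; intros v. apply Phi_end.
Qed.

Lemma splits_map {T U} (f : T -> U) S :
  splits (map f S) = map (fun p => (map f (fst p), map f (snd p))) (splits S).
Proof.
  induction S as [|b S IH]; simpl; [reflexivity|]. rewrite IH; clear IH.
  induction (splits S) as [|p l IHl]; simpl; [reflexivity|]. rewrite IHl. reflexivity.
Qed.

Lemma counter_vanish u l v : (0 < fst l)%nat -> counter (u ++ l :: v) = f0.
Proof.
  intros Hl. unfold counter. rewrite forallb_app. simpl. unfold is_zero at 2.
  destruct (Nat.eqb_spec (fst l) 0); [lia|]. simpl. rewrite Bool.andb_false_r. reflexivity.
Qed.

Lemma fadd_0_r f : (f + f0 = f)%fam.
Proof. ring. Qed.

(** A cut beyond the leading block puts a letter of positive exponent into the argument of
    [counter], which then vanishes; only cuts of the leading zeros survive. *)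
Lemma Sum_words_psi S q :
  List.Forall (fun t => (0 < fst (fst t))%nat) q ->
  Sum (words (map zlet S, q)) psi = blockH S (tailG q).
Proof.
  intros Hq. unfold psi. rewrite Sum_conv.
  transitivity (Sum (map (fun s => ((fst s, []), (snd s, q))) (splits (map zlet S)))
     (fun c => Sum (words (fst c)) counter * Sum (words (snd c)) phi)%fam).
  - destruct q as [|[l S'] q]; simpl qcuts; rewrite Sum_app; [exact (fadd_0_r _)|].
    rewrite (Sum_map (qcuts S' q)). inversion Hq as [|? ? Hl Hq']; subst. simpl in Hl.
    rewrite (Sum_zero (qcuts S' q)); [exact (fadd_0_r _)|]. intros c _. cbn [fst snd].
    rewrite Sum_words, Sum_zero; [ring|]. intros u _. rewrite Sum_qwords_cons.
    apply Sum_zero. intros v _. apply counter_vanish; auto.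
  - rewrite Sum_map, splits_map, Sum_map. unfold blockH. apply Sum_ext. intros [T U]. cbn [fst snd].
    rewrite Sum_words_phi, Sum_words, <- Sum_counter. f_equal.
    apply Sum_ext; intros u. simpl. rewrite app_nil_r. ring.
Qed.

(** A Leibniz rule: the letter to which [b] is added lies in one of the two parts. *)
Lemma Sum_bumps_splits b S (h : list V * list V -> fam) :
  Sum (bumps b S) (fun S' => Sum (splits S') h)
  = Sum (splits S) (fun p => Sum (bumps b (fst p)) (fun T => h (T, snd p))
                             + Sum (bumps b (snd p)) (fun U => h (fst p, U)))%fam.
Proof.
  revert h; induction S as [|c S IH]; intros h; [simpl; ring|].
  rewrite Sum_bumps_cons, !Sum_splits_cons.
  rewrite (Sum_ext (bumps b S) _ _ (fun w => Sum_splits_cons c w h)), Sum_add, !IH.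
  cbn [fst snd].
  rewrite (Sum_ext (splits S) (fun p => Sum (bumps b (c :: fst p)) _ + _)%fam
    (fun p => h (vadd b c :: fst p, snd p)
      + (Sum (bumps b (fst p)) (fun T => h (c :: T, snd p))
         + Sum (bumps b (snd p)) (fun U => h (c :: fst p, U))))%fam)
    by (intros p; rewrite Sum_bumps_cons; ring).
  rewrite (Sum_ext (splits S) (fun p => _ + Sum (bumps b (c :: snd p)) _)%fam
    (fun p => h (fst p, vadd b c :: snd p)
      + (Sum (bumps b (fst p)) (fun T => h (T, c :: snd p))
         + Sum (bumps b (snd p)) (fun U => h (fst p, c :: U))))%fam)
    by (intros p; rewrite Sum_bumps_cons; ring).
  rewrite !Sum_add. ring.
Qed.

(** The letter [b] joins the counterterm, giving [1 / b], or the iterated sum, giving [qf b]; the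
    diagonal terms of both recursions combine by the Leibniz rule. *)
Lemma blockH_cons b S G :
  Vpos b -> List.Forall Vpos S ->
  (blockH (b :: S) G
   = fconst (vinv b) * blockH S G + qf b * blockH S (fun t => G (vadd t b))
     - feps * Sum (bumps b S) (fun S' => blockH S' G))%fam.
Proof.
  intros Hb HS. unfold blockH. rewrite Sum_splits_cons, Sum_bumps_splits. cbn [fst snd].
  rewrite <- !Sum_mul_l, <- !Sum_add.
  match goal with |- _ = (Sum _ ?f - Sum _ ?g)%fam =>
    replace (Sum (splits S) f - Sum (splits S) g)%fam
      with (Sum (splits S) (fun p => f p + - g p)%fam)
      by (rewrite Sum_add, Sum_opp; ring) end.
  apply Sum_ext_in; intros [T U] Hp. cbn [fst snd].
  destruct (splits_in Vpos S _ Hp HS) as [_ HU]. cbn [snd] in HU.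
  rewrite cs_cons, blockF_cons by auto. rewrite Sum_mul_l, Sum_mul_r. ring.
Qed.

(** * Words of a pattern *)

Definition letters {T} (p : pattern T) : list T :=
  fst p ++ flat_map (fun t => fst t :: snd t) (snd p).

Lemma words_perm {T} (p : pattern T) w : In w (words p) -> Permutation (letters p) w.
Proof.
  destruct p as [S q]. unfold letters; cbn [fst snd].
  revert S w; induction q as [|[l S'] q IH]; intros S w Hw; unfold words in Hw; cbn [fst snd] in Hw;
    apply in_flat_map in Hw as [u [Hu Hw]]; apply in_map_iff in Hw as [v [<- Hv]];
    apply perms_perm in Hu.
  - destruct Hv as [<-|[]]. simpl. rewrite !app_nil_r; auto.
  - simpl in Hv. apply in_map_iff in Hv as [v' [<- Hv]].
    apply Permutation_app; auto. simpl. constructor. apply IH; auto.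
Qed.

Lemma letters_length {T} (p : pattern T) : length (letters p) = psize p.
Proof.
  destruct p as [S q]. unfold letters, psize; cbn [fst snd]. rewrite length_app. f_equal.
  induction q as [|[l B] q IH]; simpl; [reflexivity|]. rewrite length_app, IH; reflexivity.
Qed.

Lemma wt_perm w w' : Permutation w w' -> wt w = wt w'.
Proof. induction 1; simpl; try lia. Qed.

Lemma words_not_nil {T} (p : pattern T) w : In w (words p) -> psize p <> 0%nat -> w <> [].
Proof.
  intros Hw Hp ->. apply words_perm, Permutation_length in Hw.
  rewrite letters_length in Hw. auto.
Qed.

Lemma words_empty {T} (p : pattern T) : psize p = 0%nat -> words p = [[]].
Proof. intros Hp. rewrite (psize_0 p Hp). reflexivity. Qed.

(** * Existence of limits *)

Section limits.
Context {F : (X -> Prop) -> Prop} {FF : Filter F}.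

Definition HL (f : X -> R) : Prop := exists L : R, filterlim f F (locally L).
Definition HLf (f : fam) : Prop := forall n, HL (fun x => f x n).
(** Three kinds of parameters: a letter of a zero block; a sum of such letters, possibly empty and
    hence only nonnegative; and a parameter with positive limit. *)
Definition Zf (b : V) : Prop := Vpos b /\ filterlim b F (locally 0).
Definition Z0 (b : V) : Prop := (forall x, 0 <= b x) /\ filterlim b F (locally 0).
Definition Pf (c : V) : Prop := Vpos c /\ exists l, 0 < l /\ filterlim c F (locally l).

Lemma filterlim_Rplus (f g : X -> R) a b :
  filterlim f F (locally a) -> filterlim g F (locally b) ->
  filterlim (fun x => f x + g x) F (locally (a + b)).
Proof.
  intros Hf Hg. eapply filterlim_comp_2; [exact Hf|exact Hg|].
  apply (filterlim_plus (V := R_NormedModule) a b).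
Qed.

Lemma filterlim_Rmult (f g : X -> R) a b :
  filterlim f F (locally a) -> filterlim g F (locally b) ->
  filterlim (fun x => f x * g x) F (locally (a * b)).
Proof.
  intros Hf Hg. eapply filterlim_comp_2; [exact Hf|exact Hg|].
  apply (filterlim_mult (K := R_AbsRing) a b).
Qed.

Lemma HL_ext f g : (forall x, f x = g x) -> HL f -> HL g.
Proof. intros E [L H]. exists L. eapply filterlim_ext; eauto. Qed.

Lemma HL_const c : HL (fun _ => c).
Proof. exists c. apply filterlim_const. Qed.

Lemma HL_plus f g : HL f -> HL g -> HL (fun x => f x + g x).
Proof. intros [a Ha] [b Hb]. exists (a + b). apply filterlim_Rplus; auto. Qed.

Lemma HL_mult f g : HL f -> HL g -> HL (fun x => f x * g x).
Proof. intros [a Ha] [b Hb]. exists (a * b). apply filterlim_Rmult; auto. Qed.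

Lemma HL_pow f n : HL f -> HL (fun x => f x ^ n).
Proof.
  intros Hf; induction n as [|n IH]; [apply (HL_const 1)|]. apply (HL_mult f); auto.
Qed.

Lemma filterlim_Rinv_pos (f : X -> R) l :
  0 < l -> filterlim f F (locally l) -> filterlim (fun x => / f x) F (locally (/ l)).
Proof.
  intros Hl Hf. eapply filterlim_comp; [exact Hf|].
  apply (filterlim_Rbar_inv l). intros E; inversion E; lra.
Qed.

Lemma HLf_ext f g : f = g -> HLf f -> HLf g.
Proof. intros <-; auto. Qed.

Lemma HLf_add f g : HLf f -> HLf g -> HLf (f + g)%fam.
Proof. intros Hf Hg n. apply HL_plus; auto. Qed.

Lemma HLf_opp f : HLf f -> HLf (- f)%fam.
Proof.
  intros Hf n. apply (HL_ext (fun x => -1 * f x n)); [intros x; unfold fopp, sopp; ring|].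
  apply HL_mult; auto using HL_const.
Qed.

Lemma HLf_sub f g : HLf f -> HLf g -> HLf (f - g)%fam.
Proof.
  intros Hf Hg. apply (HLf_ext (f + - g)%fam); [ring|]. apply HLf_add; auto using HLf_opp.
Qed.

Lemma HLf_mul f g : HLf f -> HLf g -> HLf (f * g)%fam.
Proof.
  intros Hf Hg n. unfold fmul, smul. revert f Hf.
  induction n as [|n IH]; intros f Hf; simpl.
  - apply HL_mult; auto.
  - apply HL_plus; [apply HL_mult; auto|].
    apply (IH (fun x => stail (f x))). intros m. apply (Hf (S m)).
Qed.

Lemma HLf_const c : (forall x y, c x = c y :> series) -> HLf c.
Proof.
  intros H n. apply (HL_ext (fun _ => c (fun _ => mkposreal 1 Rlt_0_1) n)).
  - intros x. rewrite (H x (fun _ => mkposreal 1 Rlt_0_1)). reflexivity.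
  - apply HL_const.
Qed.

Lemma HLf_Sum {T} (l : list T) f : (forall a, In a l -> HLf (f a)) -> HLf (Sum l f).
Proof.
  induction l as [|a l IH]; intros H; simpl; [apply HLf_const; reflexivity|].
  apply HLf_add; auto with datatypes.
Qed.

Lemma HLf_trunc N f : HLf f -> HLf (trunc N f).
Proof.
  intros H n. unfold trunc. destruct (Nat.ltb n N); [apply H|apply HL_const].
Qed.

Lemma Zf_add b c : Zf b -> Zf c -> Zf (vadd b c).
Proof.
  intros [Hb Lb] [Hc Lc]. split; [apply Vpos_add; auto|].
  rewrite <- (Rplus_0_r 0) at 1. apply filterlim_Rplus; auto.
Qed.

Lemma Z0_add r b : Z0 r -> Zf b -> Z0 (vadd r b).
Proof.
  intros [Hr Lr] [Hb Lb]. split.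
  - intros x. specialize (Hr x); specialize (Hb x). unfold vadd; lra.
  - rewrite <- (Rplus_0_r 0) at 1. apply filterlim_Rplus; auto.
Qed.

Lemma Z0_zero : Z0 vzero.
Proof. split; [intros x; unfold vzero; lra|apply filterlim_const]. Qed.

Lemma Pf_add_Zf c b : Pf c -> Zf b -> Pf (vadd c b).
Proof.
  intros [Hc [l [Hl Lc]]] [Hb Lb]. split; [apply Vpos_add; auto|]. exists l; split; auto.
  rewrite <- (Rplus_0_r l). apply filterlim_Rplus; auto.
Qed.

Lemma Pf_add c b : Pf c -> Pf b -> Pf (vadd c b).
Proof.
  intros [Hc [l [Hl Lc]]] [Hb [m [Hm Lb]]]. split; [apply Vpos_add; auto|].
  exists (l + m); split; [lra|]. apply filterlim_Rplus; auto.
Qed.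

(** * Functions with limits of divided differences of every order *)

(** The index counts the letters that may still be removed: each removal uses one shift and one
    difference quotient. The increments [b] are themselves functions tending to 0, so convergence of
    the quotients is required directly along the filter. *)
Fixpoint nice (n : nat) (G : V -> X -> R) : Prop :=
  match n with
  | O => forall r, Z0 r -> HL (G r)
  | S m => nice m G /\ forall b, Zf b ->
      nice m (fun r => G (vadd r b)) /\
      nice m (fun r x => / b x * (G (vadd r b) x - G r x))
  end.

Lemma nice_ext n G G' :
  (forall r x, Z0 r -> G r x = G' r x) -> nice n G -> nice n G'.
Proof.
  revert G G'; induction n as [|n IH]; intros G G' E.
  - intros H r Hr. apply (HL_ext (G r)); auto.
  - intros [H HD]. split; [apply (IH G); auto|]. intros b Hb. destruct (HD b Hb) as [H1 H2].
    split; [refine (IH _ _ _ H1)|refine (IH _ _ _ H2)]; intros r x Hr; cbv beta;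
      rewrite !E; auto using Z0_add.
Qed.

Lemma nice_const n c : HL c -> nice n (fun _ => c).
Proof.
  revert c; induction n as [|n IH]; intros c Hc; [intros r Hr; auto|].
  split; [auto|]. intros b Hb. split; [auto|].
  apply (nice_ext n (fun _ _ => 0)); [intros; ring|]. apply IH, HL_const.
Qed.

Lemma nice_add n G H : nice n G -> nice n H -> nice n (fun r x => G r x + H r x).
Proof.
  revert G H; induction n as [|n IH]; intros G H HG HH.
  - intros r Hr. apply HL_plus; auto.
  - destruct HG as [G1 G2], HH as [H1 H2]. split; [auto|]. intros b Hb.
    destruct (G2 b Hb) as [G3 G4], (H2 b Hb) as [H3 H4]. split; [auto|].
    eapply nice_ext; [|apply (IH _ _ G4 H4)]. intros r x Hr; cbv beta; ring.
Qed.

Lemma nice_mul n G H : nice n G -> nice n H -> nice n (fun r x => G r x * H r x).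
Proof.
  revert G H; induction n as [|n IH]; intros G H HG HH.
  - intros r Hr. apply HL_mult; auto.
  - destruct HG as [G1 G2], HH as [H1 H2]. split; [auto|]. intros b Hb.
    destruct (G2 b Hb) as [G3 G4], (H2 b Hb) as [H3 H4]. split; [apply (IH _ _ G3 H3)|].
    eapply nice_ext; [|apply (nice_add _ _ _ (IH _ _ G4 H3) (IH _ _ G1 H4))].
    intros r x Hr; cbv beta; ring.
Qed.

Lemma Zf_HL b : Zf b -> HL b.
Proof. intros [_ H]; exists 0; exact H. Qed.

Lemma nice_linear n c : HL c -> nice n (fun r x => r x + c x).
Proof.
  revert c; induction n as [|n IH]; intros c Hc.
  - intros r [_ Hr]. apply HL_plus; [exists 0|]; auto.
  - split; [auto|]. intros b Hb. split.
    + apply (nice_ext n (fun r x => r x + (b x + c x))); [intros; unfold vadd; ring|].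
      apply IH, HL_plus; auto using Zf_HL.
    + apply (nice_ext n (fun _ _ => 1)); [|apply nice_const, HL_const].
      intros r x Hr. destruct Hb as [Hb _]. specialize (Hb x). unfold vadd; field; lra.
Qed.

(** The difference quotient of [1 / (r + c)] is [- 1 / ((r + c) (r + b + c))], a product of
    functions of the same kind. *)
Lemma nice_inv n c : Pf c -> nice n (fun r x => / (r x + c x)).
Proof.
  revert c; induction n as [|n IH]; intros c Hc.
  - intros r [Hr Lr]. destruct Hc as [Hc [l [Hl Lc]]].
    exists (/ (0 + l)). apply filterlim_Rinv_pos; [lra|]. apply filterlim_Rplus; auto.
  - split; [auto|]. intros b Hb.
    assert (HS : nice n (fun r x => / (r x + vadd c b x))) by (apply IH, Pf_add_Zf; auto).
    split.
    + eapply nice_ext; [|exact HS]. intros r x Hr; cbv beta. f_equal. unfold vadd; ring.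
    + eapply nice_ext;
        [|apply (nice_mul _ _ _ (nice_const n (fun _ => -1) (HL_const _))
                   (nice_mul _ _ _ (IH c Hc) HS))].
      intros r x [Hr _]; cbv beta. destruct Hb as [Hb _], Hc as [Hc _].
      specialize (Hr x); specialize (Hb x); specialize (Hc x). unfold vadd; field. lra.
Qed.

Lemma nice_pow n G m : nice n G -> nice n (fun r x => G r x ^ m).
Proof.
  intros HG; induction m as [|m IH]; [apply (nice_const n (fun _ => 1)), HL_const|].
  apply (nice_mul n G); auto.
Qed.

Definition nicef (G : V -> fam) : Prop := forall i n, nice n (fun r x => G r x i).

Lemma nicef_const c : HLf c -> nicef (fun _ => c).
Proof. intros Hc i n. apply (nice_const n (fun x => c x i)), Hc. Qed.

Lemma nicef_add G H : nicef G -> nicef H -> nicef (fun r => G r + H r)%fam.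
Proof. intros HG HH i n. apply (nice_add n (fun r x => G r x i) (fun r x => H r x i)); auto. Qed.

Lemma nicef_mul G H : nicef G -> nicef H -> nicef (fun r => G r * H r)%fam.
Proof.
  intros HG HH i n. unfold fmul, smul. revert G HG.
  induction i as [|i IH]; intros G HG; simpl.
  - apply (nice_mul n (fun r x => G r x O) (fun r x => H r x O)); auto.
  - apply (nice_add n (fun r x => G r x O * H r x (S i)) (fun r x => cauchy_coef i (stail (G r x)) (H r x))).
    + apply (nice_mul n (fun r x => G r x O) (fun r x => H r x (S i))); auto.
    + apply (IH (fun r x => stail (G r x))). intros j m. apply (HG (S j)).
Qed.

Lemma nicef_Sum {T} (l : list T) (G : V -> T -> fam) :
  (forall a, In a l -> nicef (fun r => G r a)) -> nicef (fun r => Sum l (G r)).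
Proof.
  induction l as [|a l IH]; intros H; simpl.
  - apply nicef_const, HLf_const; reflexivity.
  - apply (nicef_add (fun r => G r a)); auto with datatypes.
Qed.

Lemma nicef_qf c : Pf c -> nicef (fun r => qf (vadd r c)).
Proof.
  intros Hc i n. unfold qf, qser. destruct i as [|i].
  - eapply nice_ext; [|apply (nice_mul n _ _ (nice_const n (fun _ => -1) (HL_const _)) (nice_inv n c Hc))].
    intros r x _; cbv beta. unfold vadd; ring.
  - apply (nice_mul n (fun _ _ => bern (S i))); [apply (nice_const n (fun _ => bern (S i))), HL_const|].
    apply nice_pow. apply nice_linear. destruct Hc as [_ [l [_ Hl]]]. exists l; auto.
Qed.

Lemma nicef_mom i c : Pf c -> nicef (fun r => mom i (vadd r c)).
Proof.
  intros Hc. induction i as [i IH] using lt_wf_ind.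
  assert (E : (fun r => mom i (vadd r c)) = (fun r => qf (vadd r c) * (fpow feps i
     + Sum (seq 0 i) (fun k => fconst (fun _ => Binomial.C i k) * fpow feps (i - 1 - k)
        * mom k (vadd r c))))%fam)
    by (apply functional_extensionality; intros r; apply mom_eq).
  assert (Hp : forall j, HLf (fpow feps j)).
  { intros j; apply HLf_const. intros x y. induction j as [|j IHj]; [reflexivity|].
    simpl. unfold fmul. rewrite IHj. reflexivity. }
  rewrite E. apply nicef_mul; [apply nicef_qf; auto|].
  apply nicef_add; [apply nicef_const; auto|]. apply nicef_Sum. intros k Hk.
  apply in_seq in Hk. apply nicef_mul; [|apply IH; lia].
  apply nicef_const, HLf_mul; auto. apply HLf_const; reflexivity.
Qed.

(** Every partial sum to the right contains [c], whose limit is positive, so no factor becomes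
    singular. *)
Lemma nicef_phi1 w a c :
  Pf c -> List.Forall (fun l : letter => Zf (snd l) \/ Pf (snd l)) w ->
  nicef (fun r => phi1 w a (vadd r c)).
Proof.
  intros Hc Hw; revert a c Hc; induction Hw as [|[b u] w Hu Hw IH]; intros a c Hc.
  - apply nicef_mom; auto.
  - cbn [phi1]. apply nicef_Sum. intros i Hi. apply nicef_mul.
    + apply nicef_mul; [apply nicef_const, HLf_const; reflexivity|apply nicef_mom; auto].
    + assert (E : (fun r => phi1 w (b + (a - i)) (vadd (vadd r c) u))
                  = (fun r => phi1 w (b + (a - i)) (vadd r (vadd c u))))
        by (apply functional_extensionality; intros r; rewrite vadd_assoc; reflexivity).
      rewrite E. apply IH. simpl in Hu. destruct Hu; [apply Pf_add_Zf|apply Pf_add]; auto.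
Qed.

(** * Convergence of the symmetrised functional and of its Birkhoff decomposition *)

Definition zero_letter (l : letter) : Prop := fst l = O /\ Zf (snd l).
Definition nonzero_letter (l : letter) : Prop := (0 < fst l)%nat /\ Pf (snd l).
Definition valid : pattern letter -> Prop := pforall zero_letter nonzero_letter.

Lemma words_letters p w :
  valid p -> In w (words p) -> List.Forall (fun l : letter => Zf (snd l) \/ Pf (snd l)) w.
Proof.
  intros [HS Hq] Hw. apply words_perm in Hw. eapply Forall_perm; [exact Hw|].
  destruct p as [S q]; unfold letters; cbn [fst snd] in *. apply List.Forall_app; split.
  - eapply List.Forall_impl; [|exact HS]. intros l [_ H]; auto.
  - clear Hw. induction Hq as [|[l B] q [[_ Hl] HB] Hq IH]; simpl in *; constructor; [auto|].
    apply List.Forall_app; split; auto.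
    eapply List.Forall_impl; [|exact HB]. intros l' [_ H]; auto.
Qed.

Lemma nicef_tailG S q : valid (S, q) -> nicef (tailG q).
Proof.
  intros [HS Hq]. cbn [fst snd] in Hq. destruct q as [|[[a c] B] q].
  - apply nicef_const, HLf_const; reflexivity.
  - inversion Hq as [|? ? [[_ Hc] HB] Hq']; subst. cbn [fst snd] in *.
    unfold tailG. apply nicef_Sum. intros v Hv. apply nicef_phi1; auto.
    eapply words_letters; [|exact Hv]. split; auto.
Qed.

Lemma fconst_mul_coef v f x n : (fconst v * f)%fam x n = v x * f x n.
Proof.
  unfold fmul, fconst. rewrite smul_rsum, rsum_shift, Nat.sub_0_r.
  rewrite rsum_zero; [simpl; ring|]. intros i Hi; simpl; ring.
Qed.

(** The continuation enters each term only as its last factor, so [blockH] is linear in it. *)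
Lemma blockH_diff S c G G' :
  (blockH S (fun r => c * (G r - G' r)) = c * (blockH S G - blockH S G'))%fam.
Proof.
  assert (EF : forall U, (blockF U (fun r => c * (G r - G' r)) = c * (blockF U G - blockF U G'))%fam).
  { intros U. unfold blockF. induction (perms U) as [|u l IH]; simpl; [ring|]. rewrite IH.
    rewrite (Phi_end _ u (fun r => _)), (Phi_end _ u G), (Phi_end _ u G'). ring. }
  unfold blockH. induction (splits S) as [|p l IH]; simpl; [ring|]. rewrite IH, EF. ring.
Qed.

Lemma blockH_limit S G : List.Forall Zf S -> nicef G -> HLf (blockH S G).
Proof.
  assert (H : forall n S G, (length S <= n)%nat -> List.Forall Zf S -> nicef G -> HLf (blockH S G)).
  { clear S G. induction n as [|n IH]; intros [|b S] G Hn HS HG; try (simpl in Hn; lia).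
    1, 2: apply (HLf_ext (G vzero)); [unfold blockH, blockF, cs; simpl; ring
            |intros i; apply (HG i O vzero Z0_zero)].
    inversion HS as [|? ? Hb HS']; subst. simpl in Hn.
    rewrite blockH_cons; [|apply Hb|eapply List.Forall_impl; [|exact HS']; intros ? [? ?]; auto].
    set (G' := fun t => G (vadd t b)).
    (* Adding and subtracting [1 / b] times [blockH S G'] pairs [qf b] with its counterterm and
       leaves [blockH] of a difference quotient of [G]. *)
    apply (HLf_ext ((qf b + fconst (vinv b)) * blockH S G'
        - blockH S (fun r => fconst (vinv b) * (G' r - G r))
        - feps * Sum (bumps b S) (fun S' => blockH S' G))%fam).
    - rewrite blockH_diff. ring.
    - apply HLf_sub; [apply HLf_sub|]; [apply HLf_mul| |apply HLf_mul].
      + intros [|i]; unfold fadd, sadd, qf, fconst, qser, sconst, vinv.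
        (* At index 0 the coefficient [- / b] of [qf b] meets [/ b]. *)
        * apply (HL_ext (fun _ => 0)); [intros; ring|apply HL_const].
        * apply HL_plus; [apply HL_mult; [apply HL_const|]|apply HL_const].
          apply HL_pow, Zf_HL; auto.
      + apply IH; auto; [lia|]. intros i m. apply (HG i (Datatypes.S m)); auto.
      + apply IH; auto; [lia|]. intros i m. destruct (HG i (Datatypes.S m)) as [_ HD].
        destruct (HD b Hb) as [_ HD']. eapply nice_ext; [|exact HD'].
        intros r x _; cbv beta. rewrite fconst_mul_coef. reflexivity.
      + apply HLf_const; reflexivity.
      + apply HLf_Sum. intros S' HS''. apply IH; auto.
        * rewrite (bumps_length _ _ _ HS''); lia.
        * eapply bumps_forall; [|exact HS'|exact HS'']. intros v Hv; apply Zf_add; auto. }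
  apply (H (length S)); auto.
Qed.

Lemma psi_limit p : valid p -> HLf (Sum (words p) psi).
Proof.
  intros Hp. destruct p as [S q].
  assert (E : S = map zlet (map snd S)).
  { destruct Hp as [HS _]. cbn [fst] in HS. induction HS as [|[a v] S [Ha _] HS IH]; [reflexivity|].
    simpl in *. subst a. rewrite <- IH. reflexivity. }
  rewrite E, Sum_words_psi.
  - apply blockH_limit; [|eapply nicef_tailG; eauto]. destruct Hp as [HS _]. cbn [fst] in HS.
    clear E. induction HS as [|l S [_ Hl] HS IH]; simpl; constructor; auto.
  - destruct Hp as [_ Hq]. eapply List.Forall_impl; [|exact Hq]. intros t [[Ht _] _]; exact Ht.
Qed.

Lemma Sum_trunc {T} N (l : list T) f :
  Sum l (fun w => - trunc N (f w))%fam = (- trunc N (Sum l f))%fam.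
Proof.
  induction l as [|a l IH]; simpl.
  - apply fam_ext; intros x n. unfold fopp, sopp, trunc, f0, sconst. destruct (Nat.ltb n N), n; ring.
  - rewrite IH. apply fam_ext; intros x n. unfold fopp, sopp, trunc, fadd, sadd.
    destruct (Nat.ltb n N); ring.
Qed.

(** All words of a pattern have the same weight, so the truncation can be taken after summing over
    them; the cuts in the remaining convolution then involve counterterms of smaller patterns. *)
Lemma bminus_psi_limit p :
  valid p -> psize p <> 0%nat -> HLf (Sum (words p) (bminus wt psi)).
Proof.
  remember (psize p) as n eqn:Hn. revert p Hn.
  induction n as [n IH] using lt_wf_ind. intros p Hn Hp Hn0. subst n.
  rewrite (Sum_ext_in _ _ (fun w =>
    - trunc (wt (letters p)) (psi w + conv (nil0 (bminus wt psi)) (nil0 psi) w))%fam).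
  2:{ intros w Hw. rewrite bminus_eq by (apply (words_not_nil p w Hw); assumption).
      rewrite (wt_perm _ _ (words_perm p w Hw)). reflexivity. }
  rewrite Sum_trunc. apply HLf_opp, HLf_trunc. rewrite Sum_add.
  apply HLf_add; [apply psi_limit; auto|]. destruct p as [S q]. rewrite Sum_conv.
  apply HLf_Sum. intros [p1 p2] Hc. cbn [fst snd].
  destruct (qcuts_spec _ _ _ _ _ Hc Hp) as [V1 [V2 Hs]]. cbn [fst snd] in *.
  destruct (Nat.eq_dec (psize p1) 0) as [Z1|Z1].
  { rewrite (words_empty p1 Z1). apply (HLf_ext f0); [simpl; ring|apply HLf_const; reflexivity]. }
  destruct (Nat.eq_dec (psize p2) 0) as [Z2|Z2].
  { rewrite (words_empty p2 Z2). apply (HLf_ext f0); [simpl; ring|apply HLf_const; reflexivity]. }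
  apply HLf_mul.
  - rewrite (Sum_ext_in _ _ (bminus wt psi)).
    + apply (IH (psize p1)); auto; lia.
    + intros w Hw. apply words_not_nil in Hw; auto. destruct w; easy.
  - rewrite (Sum_ext_in _ _ psi); [apply psi_limit; auto|].
    intros w Hw. apply words_not_nil in Hw; auto. destruct w; easy.
Qed.

(* The coefficient of index [wt w] is the constant term of the renormalised Laurent series. *)
Definition zplus (w : list letter) : fam :=
  (phi w + conv (nil0 (bminus wt phi)) (nil0 phi) w)%fam.

(** Word by word, [birkhoff_twist] exchanges [phi] for [psi] at index [wt w]; the symmetrised
    convolution for [psi] is a finite sum of products of convergent factors. *)
Lemma zplus_limit p :
  valid p -> psize p <> 0%nat ->
  HL (fun x => Sum (words p) zplus x (wt (letters p))).
Proof.
  intros Hp Hn.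
  assert (H : HLf (Sum (words p) (conv (nil1 (bminus wt psi)) psi))).
  { destruct p as [S q]. rewrite Sum_conv. apply HLf_Sum. intros [p1 p2] Hc. cbn [fst snd].
    destruct (qcuts_spec _ _ _ _ _ Hc Hp) as [V1 [V2 _]]. cbn [fst snd] in *.
    apply HLf_mul; [|apply psi_limit; auto].
    destruct (Nat.eq_dec (psize p1) 0) as [Z1|Z1].
    - rewrite (words_empty p1 Z1). apply HLf_const; reflexivity.
    - rewrite (Sum_ext_in _ _ (bminus wt psi)); [apply bminus_psi_limit; auto|].
      intros w Hw. apply words_not_nil in Hw; auto. destruct w; easy. }
  eapply HL_ext; [|apply (H (wt (letters p)))]. intros x; cbv beta.
  assert (HW : forall w, In w (words p) -> w <> [] /\ wt w = wt (letters p)).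
  { intros w Hw. split; [apply (words_not_nil p w Hw); assumption|].
    symmetry; apply wt_perm, words_perm; auto. }
  clear H. induction (words p) as [|w l IH]; [reflexivity|].
  cbn [Sum]. unfold fadd, sadd. rewrite IH by auto with datatypes. f_equal.
  destruct (HW w) as [Hw <-]; [auto with datatypes|]. symmetry.
  apply birkhoff_twist; auto using wt_app, counter_nil, counter_polar.
Qed.

End limits.

(** * The iterated sums and their expansions *)

Definition lsumR {T} (l : list T) (f : T -> R) : R := fold_right (fun a r => f a + r) 0 l.

Lemma lsumR_ext {T} (l : list T) f g :
  (forall a, In a l -> f a = g a) -> lsumR l f = lsumR l g.
Proof.
  induction l as [|a l IH]; intros H; simpl; [reflexivity|].
  rewrite H, IH; auto with datatypes.
Qed.

Lemma lsumR_scal {T} (l : list T) c f : lsumR l (fun a => c * f a) = c * lsumR l f.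
Proof. induction l as [|a l IH]; simpl; [ring|rewrite IH; ring]. Qed.

Lemma lsumR_app {T} (l l' : list T) f : lsumR (l ++ l') f = lsumR l f + lsumR l' f.
Proof. induction l as [|a l IH]; simpl; [ring|rewrite IH; ring]. Qed.

Lemma sum_f_R0_lsumR f n : sum_f_R0 f n = lsumR (seq 0 (S n)) f.
Proof.
  induction n as [|n IH]; [simpl; ring|].
  rewrite (seq_S (S n) 0), lsumR_app, <- IH. simpl. ring.
Qed.

Lemma lsumR_sum_f_R0 {T} (l : list T) (f : T -> nat -> R) n :
  lsumR l (fun a => sum_f_R0 (f a) n) = sum_f_R0 (fun k => lsumR l (fun a => f a k)) n.
Proof.
  induction n as [|n IH]; simpl; [reflexivity|]. rewrite <- IH.
  clear IH. induction l as [|a l IH]; simpl; [ring|rewrite IH; ring].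
Qed.

Lemma is_series_lsumR {T} (l : list T) (f : T -> nat -> R) (s : T -> R) :
  (forall a, In a l -> is_series (f a) (s a)) ->
  is_series (fun n => lsumR l (fun a => f a n)) (lsumR l s).
Proof.
  induction l as [|a l IH]; intros H; simpl.
  - apply (filterlim_ext (fun _ => 0)); [|apply filterlim_const].
    intros n; induction n as [|n IH]; [rewrite sum_O; reflexivity|].
    rewrite sum_Sn, <- IH. unfold plus; simpl; ring.
  - apply (is_series_plus (V := R_NormedModule) (f a)); auto with datatypes.
Qed.

Lemma expands_Sum {T} (l : list T) (f : T -> R -> R) N (g : T -> fam) x :
  (forall a, In a l -> expands (f a) N (g a x)) ->
  expands (fun e => lsumR l (fun a => f a e)) N (Sum l g x).
Proof.
  induction l as [|a l IH]; intros H; simpl.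
  - induction N as [|N IHN]; [apply expands_const|].
    replace (f0 x) with (smul seps (f0 x)) by (unfold f0; ring). apply expands_eps; auto.
    apply IHN. intros b [].
  - apply expands_add; auto with datatypes.
Qed.

Lemma expands_fpow f N a k x : expands f N a -> expands f (k + N) (smul (fpow feps k x) a).
Proof.
  intros H; induction k as [|k IH]; simpl.
  - replace (smul (f1 x) a) with a by (unfold f1; ring). exact H.
  - replace (smul ((feps * fpow feps k)%fam x) a) with (smul seps (smul (fpow feps k x) a))
      by (unfold fmul, feps; ring).
    apply expands_eps; auto.
Qed.

Definition zterm (a : nat) (v : R) (W : nat -> R) (e : R) (n : nat) : R :=
  if Nat.eqb n 0 then 0 else exp (e * (INR n * v)) * INR n ^ a * W n.

Definition mterm (i : nat) (v : R) (e : R) : nat -> R := zterm i v (fun _ => 1) e.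

Definition momv (i : nat) (v e : R) : R := Series (mterm i v e).

Lemma binomial_lsumR x y n :
  (x + y) ^ n = lsumR (seq 0 (S n)) (fun i => Binomial.C n i * x ^ i * y ^ (n - i)).
Proof. rewrite binomial, sum_f_R0_lsumR. reflexivity. Qed.

Lemma ex_series_mterm i v e : 0 < v -> e < 0 -> ex_series (mterm i v e).
Proof.
  intros Hv He. apply ex_series_incr_1.
  apply (ex_series_ext (fun n => Rabs (mterm i v e (S n)))).
  { intros n. apply Rabs_pos_eq. unfold mterm, zterm. simpl Nat.eqb. cbv iota.
    rewrite Rmult_1_r. apply Rmult_le_pos; [left; apply exp_pos|apply pow_le, pos_INR]. }
  assert (Hev : e * v < 0) by nra.
  apply (ex_series_DAlembert (fun n => mterm i v e (S n)) (exp (e * v))).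
  - rewrite <- exp_0. apply exp_increasing; auto.
  - intros n. unfold mterm, zterm. simpl Nat.eqb. cbv iota.
    rewrite Rmult_1_r. apply Rmult_integral_contrapositive_currified.
    + apply Rgt_not_eq, exp_pos.
    + apply pow_nonzero, not_0_INR; lia.
  - apply (is_lim_seq_ext (fun n => (1 + / INR (S n)) ^ i * exp (e * v))).
    + intros n. unfold mterm, zterm. simpl Nat.eqb. cbv iota. rewrite !Rmult_1_r.
      rewrite (S_INR (S n)).
      assert (Hn : 0 < INR (S n)) by (apply lt_0_INR; lia).
      replace (e * ((INR (S n) + 1) * v)) with (e * (INR (S n) * v) + e * v) by ring.
      rewrite exp_plus.
      replace (INR (S n) + 1) with ((1 + / INR (S n)) * INR (S n)) by (field; lra).
      rewrite Rpow_mult_distr.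
      pose proof (exp_pos (e * (INR (S n) * v))). pose proof (pow_lt _ i Hn).
      rewrite Rabs_pos_eq.
      * field. split; lra.
      * assert (0 < / INR (S n)) by (apply Rinv_0_lt_compat; auto).
        assert (0 <= (1 + / INR (S n)) ^ i) by (apply pow_le; lra).
        pose proof (exp_pos (e * v)).
        apply Rmult_le_pos; [|left; apply Rinv_0_lt_compat, Rmult_lt_0_compat; auto].
        apply Rmult_le_pos; apply Rmult_le_pos; lra.
    + replace (Finite (exp (e * v))) with (Rbar_mult (1 ^ i) (exp (e * v)))
        by (simpl; rewrite pow1, Rmult_1_l; reflexivity).
      apply is_lim_seq_scal_r.
      assert (HL : is_lim_seq (fun n => 1 + / INR (S n)) 1).
      { replace (Finite 1) with (Finite (1 + 0)) by (rewrite Rplus_0_r; reflexivity).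
        apply is_lim_seq_plus'; [apply is_lim_seq_const|].
        apply (is_lim_seq_incr_1 (fun n => / INR n)).
        apply (is_lim_seq_inv _ p_infty is_lim_seq_INR). discriminate. }
      induction i as [|i IH]; [apply is_lim_seq_const|].
      simpl. apply (is_lim_seq_mult' _ _ 1); auto.
Qed.

(** Replacing [n] by [n + 1] and expanding [(n + 1)^i] expresses the moment through all moments up
    to [i]; solving for the one of index [i] divides by [1 - e^(e v)] and produces Q. *)
Lemma momv_rec i v e :
  0 < v -> e < 0 ->
  momv i v e
  = Qf (e * v) * (1 + lsumR (seq 0 i) (fun k => Binomial.C i k * momv k v e)).
Proof.
  intros Hv He.
  assert (Hs : forall k, is_series (mterm k v e) (momv k v e))
    by (intros k; apply Series_correct, ex_series_mterm; auto).
  assert (H1 : is_series (fun n => mterm i v e (S n)) (momv i v e)).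
  { apply is_series_incr_1. unfold mterm at 2, zterm; simpl Nat.eqb; cbv iota.
    unfold plus; simpl. rewrite Rplus_0_r. apply Hs. }
  assert (H2 : is_series (fun n => exp (e * v) * (sconst 1 n
      + lsumR (seq 0 (S i)) (fun k => Binomial.C i k * mterm k v e n)))
      (exp (e * v) * (1 + lsumR (seq 0 (S i)) (fun k => Binomial.C i k * momv k v e)))).
  { apply (is_series_scal (V := R_NormedModule) (exp (e * v))). apply (is_series_plus (V := R_NormedModule) (sconst 1)).
    - apply (filterlim_ext (fun _ => 1)); [|apply filterlim_const].
      intros n; induction n as [|n IH]; [rewrite sum_O; reflexivity|].
      rewrite sum_Sn, <- IH. unfold plus; simpl; ring.
    - apply is_series_lsumR. intros k _. apply (is_series_scal (V := R_NormedModule) (Binomial.C i k)), Hs. }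
  apply is_series_unique in H1.
  assert (H3 : momv i v e
    = exp (e * v) * (1 + lsumR (seq 0 (S i)) (fun k => Binomial.C i k * momv k v e))).
  { rewrite <- H1. apply is_series_unique. eapply is_series_ext; [|exact H2].
    intros n; real_eq. unfold mterm, zterm. simpl (Nat.eqb (S n) 0). cbv iota.
    destruct n as [|n].
    - simpl (Nat.eqb 0 0). cbv iota. rewrite (lsumR_ext _ _ (fun k => 0 * 0)) by (intros; ring).
      rewrite lsumR_scal. simpl INR. rewrite pow1. simpl sconst.
      replace (e * (1 * v)) with (e * v) by ring. ring.
    - simpl (Nat.eqb (S n) 0). cbv iota. simpl sconst. rewrite (S_INR (S n)).
      rewrite binomial_lsumR.
      replace (e * ((INR (S n) + 1) * v)) with (e * v + e * (INR (S n) * v)) by ring.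
      rewrite exp_plus, Rplus_0_l, Rmult_1_r, Rmult_assoc. f_equal. rewrite <- lsumR_scal.
      apply lsumR_ext. intros k _. rewrite pow1. ring. }
  rewrite seq_S, lsumR_app in H3. simpl in H3. rewrite C_n_n in H3.
  assert (Hev : e * v < 0) by nra.
  pose proof (Qf_denom _ Hev) as HQ. unfold Qf.
  rewrite exp_Ropp in *. pose proof (exp_pos (e * v)) as Hp.
  set (E := exp (e * v)) in *. clear H2.
  set (s := lsumR (seq 0 i) _) in *.
  assert (HE : 1 - E <> 0).
  { intros H0. replace E with 1 in HQ by lra. lra. }
  apply Rmult_eq_reg_r with (1 - E); auto.
  transitivity (E * (1 + s)).
  - rewrite Rmult_minus_distr_l, Rmult_1_r. rewrite H3 at 1. ring.
  - field. split; lra.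
Qed.

Lemma expands_mom i v x : 0 < v x -> expands (momv i (v x)) (S i) (mom i v x).
Proof.
  intros Hv. induction i as [i IH] using lt_wf_ind.
  apply (expands_ext (fun e => Qf (e * v x)
    * (1 + lsumR (seq 0 i) (fun k => Binomial.C i k * momv k (v x) e)))).
  { intros e He. symmetry; apply momv_rec; auto. }
  rewrite mom_eq. apply (expands_mul _ _ 1 i); [apply expands_qser; auto|].
  apply (expands_add (fun _ => 1)).
  - replace (fpow feps i x) with (smul (fpow feps i x) (sconst 1)) by ring.
    rewrite <- (Nat.add_0_r i) at 1. apply expands_fpow, expands_const.
  - apply (expands_Sum (seq 0 i) (fun k e => Binomial.C i k * momv k (v x) e)).
    intros k Hk. apply in_seq in Hk.
    change ((fconst (fun _ => Binomial.C i k) * fpow feps (i - 1 - k) * mom k v)%fam x)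
      with (smul (smul (sconst (Binomial.C i k)) (fpow feps (i - 1 - k) x)) (mom k v x)).
    replace (smul (smul (sconst (Binomial.C i k)) (fpow feps (i - 1 - k) x)) (mom k v x))
      with (smul (sconst (Binomial.C i k)) (smul (fpow feps (i - 1 - k) x) (mom k v x))) by ring.
    pose proof (expands_mul _ _ _ _ _ _ (expands_const (Binomial.C i k))
      (expands_fpow _ _ _ (i - 1 - k) x (IH k ltac:(lia)))) as HE.
    (* The power [i - 1 - k] in [mom] lifts the order [k + 1] of the moment of index [k] to the
       common order [i]. *)
    replace (0 + (i - 1 - k + S k))%nat with i in HE by lia. exact HE.
Qed.

Definition ev (x : X) (w : list letter) : word :=
  map (fun l => ((- Z.of_nat (fst l))%Z, snd l x)) w.

Lemma Zpart_ev a v w x m e :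
  Zpart (ev x ((a, v) :: w)) m e
  = rsum (zterm a (v x) (fun n => Zpart (ev x w) n e) e) m.
Proof.
  simpl. apply rsum_ext. intros n _. unfold zterm.
  destruct (Nat.eqb n 0); [reflexivity|]. rewrite Z.opp_involutive, <- pow_powerRZ. reflexivity.
Qed.

Lemma zterm_pos a v W e n : (forall n, 0 <= W n) -> 0 <= zterm a v W e n.
Proof.
  intros HW. unfold zterm. destruct (Nat.eqb n 0); [lra|].
  apply Rmult_le_pos; [apply Rmult_le_pos; [left; apply exp_pos|apply pow_le, pos_INR]|auto].
Qed.

Lemma Zpart_pos w x m e : 0 <= Zpart (ev x w) m e.
Proof.
  revert m; induction w as [|[a v] w IH]; intros m; [simpl; lra|].
  rewrite Zpart_ev. induction m as [|m IHm]; simpl rsum; [lra|].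
  apply Rplus_le_le_0_compat; auto. apply zterm_pos; auto.
Qed.

Lemma rsum_sum_f_R0 f n : rsum f (S n) = sum_f_R0 f n.
Proof. induction n as [|n IH]; [simpl; ring|]. simpl in *. rewrite <- IH. reflexivity. Qed.

(* Writing the largest summation index as [n = k + j], [k] being the second largest one. *)
Lemma zterm_split a b v u W e n :
  zterm a v (rsum (zterm b u W e)) e n
  = lsumR (seq 0 (S a)) (fun i => Binomial.C a i *
      sum_f_R0 (fun k => zterm (b + (a - i)) (v + u) W e k * mterm i v e (n - k)) n).
Proof.
  rewrite (lsumR_ext _ _ (fun i => sum_f_R0 (fun k => Binomial.C a i *
     (zterm (b + (a - i)) (v + u) W e k * mterm i v e (n - k))) n))
    by (intros; rewrite scal_sum; apply sum_eq; intros; ring).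
  rewrite lsumR_sum_f_R0.
  destruct n as [|n].
  - simpl sum_f_R0. unfold mterm, zterm. simpl Nat.eqb. cbv iota.
    rewrite (lsumR_ext _ _ (fun k => 0 * 0)) by (intros; ring). rewrite lsumR_scal; ring.
  - change (sum_f_R0 ?f (S n)) with (sum_f_R0 f n + f (S n)). cbv beta.
    rewrite (lsumR_ext _ (fun i => _ * (zterm _ _ _ _ (S n) * _)) (fun k => 0 * 0)).
    2:{ intros i _. rewrite Nat.sub_diag. unfold mterm, zterm at 2. simpl Nat.eqb. cbv iota. ring. }
    rewrite lsumR_scal, Rmult_0_l, Rplus_0_r.
    unfold zterm at 1. simpl (Nat.eqb (S n) 0). cbv iota.
    rewrite rsum_sum_f_R0, scal_sum. apply sum_eq. intros k Hk.
    unfold mterm, zterm.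
    destruct (Nat.eqb_spec k 0) as [->|Hk0].
    + rewrite (lsumR_ext _ _ (fun k => 0 * 0)) by (intros; ring). rewrite lsumR_scal; ring.
    + destruct (Nat.eqb_spec (S n - k) 0) as [H0|_]; [lia|].
      replace (INR (S n)) with (INR (S n - k) + INR k) by (rewrite <- plus_INR; f_equal; lia).
      rewrite binomial_lsumR.
      transitivity ((exp (e * (INR k * u)) * INR k ^ b * W k * exp (e * ((INR (S n - k) + INR k) * v)))
         * lsumR (seq 0 (S a)) (fun i => Binomial.C a i * INR (S n - k) ^ i * INR k ^ (a - i)));
        [ring|].
      rewrite <- lsumR_scal. apply lsumR_ext. intros i _.
      rewrite pow_add.
      replace (e * ((INR (S n - k) + INR k) * v)) with (e * (INR (S n - k) * v) + e * (INR k * v)) by ring.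
      replace (e * (INR k * (v + u))) with (e * (INR k * v) + e * (INR k * u)) by ring.
      rewrite !exp_plus. ring.
Qed.

(** By [zterm_split] the series over the largest index is a finite combination of Cauchy products;
    their factors have nonnegative terms, so these products converge to the products of the sums. *)
Lemma expands_phi1 w a v x :
  0 < v x -> List.Forall (fun l : letter => 0 < snd l x) w ->
  (forall e, e < 0 -> ex_series (zterm a (v x) (fun n => Zpart (ev x w) n e) e)) /\
  expands (fun e => Series (zterm a (v x) (fun n => Zpart (ev x w) n e) e))
          (S a + wt w) (phi1 w a v x).
Proof.
  intros Hv Hw; revert a v Hv. induction Hw as [|[b u] w Hu Hw IH]; intros a v Hv.
  - split.
    + intros e He. apply ex_series_mterm; auto.
    + rewrite Nat.add_0_r. apply expands_mom; auto.
  - cbn [snd] in Hu.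
    assert (Hvu : 0 < vadd v u x) by (unfold vadd; lra).
    assert (HS : forall e, e < 0 ->
      is_series (zterm a (v x) (fun n => Zpart (ev x ((b, u) :: w)) n e) e)
        (lsumR (seq 0 (S a)) (fun i => Binomial.C a i * momv i (v x) e *
          Series (zterm (b + (a - i)) (vadd v u x) (fun n => Zpart (ev x w) n e) e)))).
    { intros e He.
      eapply is_series_ext; [|apply (is_series_lsumR (seq 0 (S a)) (fun i n => Binomial.C a i *
         sum_f_R0 (fun k => zterm (b + (a - i)) (v x + u x) (fun n => Zpart (ev x w) n e) e k
            * mterm i (v x) e (n - k)) n))].
      - intros n; real_eq; cbv beta. rewrite <- zterm_split. unfold zterm at 1 3.
        destruct (Nat.eqb n 0); [reflexivity|]. rewrite Zpart_ev. reflexivity.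
      - intros i _. rewrite Rmult_assoc. apply (is_series_scal (V := R_NormedModule) (Binomial.C a i)).
        rewrite Rmult_comm. apply is_series_mult_pos.
        + apply Series_correct. apply (IH (b + (a - i))%nat (vadd v u) Hvu); auto.
        + apply Series_correct, ex_series_mterm; auto.
        + intros n; apply zterm_pos. intros; apply Zpart_pos.
        + intros n; apply zterm_pos. intros; lra. }
    split; [intros e He; eexists; apply HS; auto|].
    eapply expands_ext; [intros e He; symmetry; apply is_series_unique, HS; auto|].
    cbn [phi1]. apply expands_Sum. intros i Hi. apply in_seq in Hi.
    pose proof (expands_mul _ _ _ _ _ _
      (expands_mul _ _ _ _ _ _ (expands_const (Binomial.C a i)) (expands_mom i v x Hv))
      (proj2 (IH (b + (a - i))%nat (vadd v u) Hvu))) as HE.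
    replace (0 + S i + (S (b + (a - i)) + wt w))%nat with (S a + wt ((b, u) :: w))%nat in HE
      by (simpl; lia).
    exact HE.
Qed.

Lemma expands_Zfun w x :
  List.Forall (fun l : letter => 0 < snd l x) w -> expands (Zfun (ev x w)) (wt w) (phi w x).
Proof.
  intros Hw. destruct Hw as [|[a v] w Hv Hw].
  - apply (expands_ext (fun _ => 1)); [|apply expands_const].
    intros e He. unfold Zfun. simpl. rewrite Lim_seq_const. reflexivity.
  - cbn [snd] in Hv. destruct (expands_phi1 w a v x Hv Hw) as [H1 H2].
    eapply expands_ext; [|exact H2]. intros e He; cbv beta.
    unfold Zfun. symmetry.
    rewrite (is_lim_seq_unique _ (Series (zterm a (v x) (fun n => Zpart (ev x w) n e) e)));
      [reflexivity|].
    (* [Zpart] at [m] stops at index [m - 1], whereas a partial sum of a series includes its last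
       index. *)
    apply is_lim_seq_incr_1.
    pose proof (Series_correct _ (H1 e He)) as HS.
    eapply is_lim_seq_ext; [|exact HS]. intros n; cbv beta.
    rewrite Zpart_ev, rsum_sum_f_R0. apply sum_n_Reals.
Qed.

(** * Laurent series up to normalisation of the order *)

Definition zcoef (N : nat) (a : series) (n : Z) : R :=
  if Z.ltb (n + Z.of_nat N) 0 then 0 else a (Z.to_nat (n + Z.of_nat N)).

(** [lord x] only bounds the pole order, and for a series chosen by [epsilon] it is unknown;
    comparing the coefficients of each power of eps is independent of it. *)
Definition represents (x : laurent) (N : nat) (a : series) : Prop :=
  forall n, laurent_coef x n = zcoef N a n.

Fixpoint spow_eps (k : nat) (a : series) : series :=
  match k with O => a | S m => smul seps (spow_eps m a) end.

Lemma zcoef_eps N a n : zcoef (S N) (smul seps a) n = zcoef N a n.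
Proof.
  unfold zcoef. rewrite smul_eps.
  destruct (Z.ltb_spec (n + Z.of_nat (S N)) 0), (Z.ltb_spec (n + Z.of_nat N) 0); try lia; try easy.
  - replace (Z.to_nat (n + Z.of_nat (S N))) with O by lia. reflexivity.
  - replace (Z.to_nat (n + Z.of_nat (S N))) with (S (Z.to_nat (n + Z.of_nat N))) by lia.
    reflexivity.
Qed.

Lemma zcoef_spow K N a n : zcoef (K + N) (spow_eps K a) n = zcoef N a n.
Proof.
  induction K as [|K IH]; [reflexivity|]. simpl. rewrite zcoef_eps. exact IH.
Qed.

Lemma zcoef_inj N a b : (forall n, zcoef N a n = zcoef N b n) -> a = b.
Proof.
  intros H. apply functional_extensionality; intros j.
  specialize (H (Z.of_nat j - Z.of_nat N)%Z). unfold zcoef in H.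
  replace (Z.of_nat j - Z.of_nat N + Z.of_nat N)%Z with (Z.of_nat j) in H by lia.
  rewrite Nat2Z.id in H. destruct (Z.ltb_spec (Z.of_nat j) 0); [lia|exact H].
Qed.

(** Raising both sides to the common order [N + lord x] gives an equation between power series, to
    which the ring laws apply. *)
Lemma represents_iff x N a :
  represents x N a <-> spow_eps N (lcoef x) = spow_eps (lord x) a.
Proof.
  unfold represents. change (laurent_coef x) with (zcoef (lord x) (lcoef x)). split; intros H.
  - apply (zcoef_inj (N + lord x)). intros n. rewrite zcoef_spow, H.
    rewrite Nat.add_comm, zcoef_spow. reflexivity.
  - intros n. rewrite <- (zcoef_spow N), H, Nat.add_comm, zcoef_spow. reflexivity.
Qed.

Lemma spow_eps_mul_l K a b : smul (spow_eps K a) b = spow_eps K (smul a b).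
Proof.
  induction K as [|K IH]; [reflexivity|]. simpl. rewrite <- IH. ring.
Qed.

Lemma spow_eps_mul_r K a b : smul a (spow_eps K b) = spow_eps K (smul a b).
Proof.
  induction K as [|K IH]; [reflexivity|]. simpl. rewrite <- IH. ring.
Qed.

Lemma spow_eps_add K M a : spow_eps (K + M) a = spow_eps K (spow_eps M a).
Proof. induction K as [|K IH]; [reflexivity|]. simpl. rewrite IH. reflexivity. Qed.

Lemma expands_spow f N a K : expands f N a -> expands f (K + N) (spow_eps K a).
Proof. intros H; induction K as [|K IH]; [exact H|]. apply expands_eps; exact IH. Qed.

Lemma represents_mul x y N M a b :
  represents x N a -> represents y M b -> represents (lmul x y) (N + M) (smul a b).
Proof.
  rewrite !represents_iff. intros Hx Hy. simpl lord.
  replace (lcoef (lmul x y)) with (smul (lcoef x) (lcoef y))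
    by (apply functional_extensionality; intros j; apply smul_rsum).
  rewrite spow_eps_add, <- spow_eps_mul_r, <- spow_eps_mul_l, Hx, Hy.
  rewrite spow_eps_mul_l, spow_eps_mul_r, <- spow_eps_add. reflexivity.
Qed.

Lemma laurent_coef_add x y n : laurent_coef (ladd x y) n = laurent_coef x n + laurent_coef y n.
Proof.
  unfold laurent_coef at 1. unfold ladd. cbn [lord lcoef].
  set (N := Nat.max (lord x) (lord y)).
  destruct (Z.ltb_spec (n + Z.of_nat N) 0) as [H|H].
  - unfold laurent_coef.
    destruct (Z.ltb_spec (n + Z.of_nat (lord x)) 0); [|lia].
    destruct (Z.ltb_spec (n + Z.of_nat (lord y)) 0); [ring|lia].
  - rewrite Z2Nat.id by lia. replace (n + Z.of_nat N - Z.of_nat N)%Z with n by lia. reflexivity.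
Qed.

Lemma represents_add x y N a b :
  represents x N a -> represents y N b -> represents (ladd x y) N (sadd a b).
Proof.
  intros Hx Hy n. rewrite laurent_coef_add, Hx, Hy. unfold zcoef, sadd.
  destruct (Z.ltb (n + Z.of_nat N) 0); ring.
Qed.

Lemma represents_opp x N a : represents x N a -> represents (lopp x) N (sopp a).
Proof.
  intros Hx n. transitivity (- laurent_coef x n).
  - unfold laurent_coef, lopp; cbn [lord lcoef]. destruct (Z.ltb _ 0); ring.
  - rewrite Hx. unfold zcoef, sopp. destruct (Z.ltb _ 0); ring.
Qed.

Lemma represents_polar x N a :
  represents x N a -> represents (lpolar x) N (fun n => if Nat.ltb n N then a n else 0).
Proof.
  intros Hx n. transitivity (if Z.ltb n 0 then laurent_coef x n else 0).
  - unfold laurent_coef, lpolar; cbn [lord lcoef].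
    destruct (Z.ltb_spec (n + Z.of_nat (lord x)) 0), (Z.ltb_spec n 0),
      (Nat.ltb_spec (Z.to_nat (n + Z.of_nat (lord x))) (lord x)); try lia; reflexivity.
  - rewrite Hx. unfold zcoef.
    destruct (Z.ltb_spec (n + Z.of_nat N) 0), (Z.ltb_spec n 0),
      (Nat.ltb_spec (Z.to_nat (n + Z.of_nat N)) N); try lia; reflexivity.
Qed.

Lemma represents_zero N : represents lzero N (sconst 0).
Proof.
  intros n. unfold laurent_coef, zcoef, lzero; cbn [lord lcoef].
  destruct (Z.ltb _ 0), (Z.ltb _ 0); try reflexivity;
    destruct (Z.to_nat (n + Z.of_nat N)); reflexivity.
Qed.

Lemma represents_lsum {T} (l : list T) (F : T -> laurent) N (g : T -> fam) x :
  (forall a, In a l -> represents (F a) N (g a x)) ->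
  represents (lsum (map F l)) N (Sum l g x).
Proof.
  induction l as [|a l IH]; intros H; simpl; [apply represents_zero|].
  apply represents_add; auto with datatypes.
Qed.

Lemma powerRZ_sub e j N : e <> 0 -> powerRZ e (Z.of_nat j - Z.of_nat N) = e ^ j * / e ^ N.
Proof.
  intros He. unfold Z.sub. rewrite powerRZ_add by auto.
  rewrite powerRZ_neg', <- !pow_powerRZ. reflexivity.
Qed.

Lemma expands_is_laurent f N a : expands f N a -> is_laurent_expansion f (Laurent N a).
Proof.
  intros [rho [H0 H]]. exists rho; split; auto. intros e He. cbn [lord lcoef].
  specialize (H e He). apply is_pseries_R in H.
  assert (Hn : e ^ N <> 0) by (apply pow_nonzero; lra).
  apply (is_series_scal (V := R_NormedModule) (/ e ^ N)) in H.
  replace (f e) with (scal (/ e ^ N) (e ^ N * f e))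
    by (unfold scal; simpl; unfold mult; simpl; field; auto).
  eapply is_series_ext; [|exact H]. intros j; real_eq; cbv beta. rewrite powerRZ_sub by lra.
  unfold scal; simpl; unfold mult; simpl. ring.
Qed.

Lemma is_laurent_expands f x : is_laurent_expansion f x -> expands f (lord x) (lcoef x).
Proof.
  intros [rho [H0 H]]. exists rho; split; auto. intros e He.
  specialize (H e He). apply is_pseries_R.
  assert (Hn : e ^ lord x <> 0) by (apply pow_nonzero; lra).
  apply (is_series_scal (V := R_NormedModule) (e ^ lord x)) in H.
  eapply is_series_ext; [|exact H]. intros j; real_eq; cbv beta. rewrite powerRZ_sub by lra.
  unfold scal; simpl; unfold mult; simpl. field; auto.
Qed.

(** The expansion just constructed shows that [epsilon] chooses an expansion at all; uniqueness at a
    common order then identifies the choice. *)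
Lemma represents_Zbar w x :
  List.Forall (fun l : letter => 0 < snd l x) w ->
  represents (Zbar (ev x w)) (wt w) (phi w x).
Proof.
  intros Hw. pose proof (expands_Zfun w x Hw) as H.
  assert (HZ : is_laurent_expansion (Zfun (ev x w)) (Zbar (ev x w))).
  { unfold Zbar. apply epsilon_spec. eexists. apply expands_is_laurent. exact H. }
  apply is_laurent_expands in HZ. apply represents_iff.
  eapply expands_unique; [apply expands_spow; exact HZ|].
  rewrite Nat.add_comm. apply expands_spow. exact H.
Qed.

Lemma conv_firstn {T} (f g : list T -> fam) w :
  conv f g w = Sum (seq 0 (S (length w))) (fun j => f (firstn j w) * g (skipn j w))%fam.
Proof.
  revert f; induction w as [|l w IH]; intros f; [simpl; ring|].
  cbn [conv length]. rewrite IH.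
  change (seq 0 (S (S (length w)))) with (0%nat :: seq 1 (S (length w))).
  rewrite <- seq_shift. cbn [Sum]. rewrite Sum_map. reflexivity.
Qed.

Lemma conv_nil0_firstn {T} (f g : list T -> fam) w :
  conv (nil0 f) (nil0 g) w
  = Sum (seq 1 (length w - 1)) (fun j => f (firstn j w) * g (skipn j w))%fam.
Proof.
  rewrite conv_firstn. destruct w as [|l w]; [simpl; ring|].
  assert (E : seq 0 (S (length (l :: w))) = 0%nat :: seq 1 (length w) ++ [length (l :: w)]).
  { change [length (l :: w)] with [(1 + length w)%nat]. rewrite <- (seq_S (length w) 1). reflexivity. }
  rewrite E. cbn [Sum]. rewrite Sum_app. cbn [Sum]. rewrite skipn_all.
  replace (length (l :: w) - 1)%nat with (length w) by (simpl; lia).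
  rewrite (Sum_ext_in (seq 1 (length w)) _ (fun j => f (firstn j (l :: w)) * g (skipn j (l :: w)))%fam).
  - simpl nil0 at 1 4. ring.
  - intros j Hj. apply in_seq in Hj. unfold nil0. destruct j as [|j]; [lia|].
    cbn [firstn]. destruct (skipn (S j) (l :: w)) eqn:Hs; [|reflexivity].
    apply (f_equal (@length T)) in Hs. rewrite length_skipn in Hs. simpl in Hs. lia.
Qed.

Lemma represents_conv_sum zm f w x :
  List.Forall (fun l : letter => 0 < snd l x) w ->
  (forall u, List.Forall (fun l : letter => 0 < snd l x) u ->
     represents (zm (ev x u)) (wt u) (f u x)) ->
  represents (conv_sum zm (ev x w)) (wt w) (conv (nil0 f) (nil0 phi) w x).
Proof.
  intros Hw Hz. unfold conv_sum. rewrite conv_nil0_firstn.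
  unfold ev at 3. rewrite length_map. apply represents_lsum. intros j _.
  unfold ev at 1 2. rewrite firstn_map, skipn_map.
  rewrite <- (firstn_skipn j w) in Hw. apply List.Forall_app in Hw as [H1 H2].
  replace (wt w) with (wt (firstn j w) + wt (skipn j w))%nat
    by (rewrite <- wt_app, firstn_skipn; reflexivity).
  apply represents_mul; [apply Hz; auto|apply represents_Zbar; auto].
Qed.

Lemma represents_Zminus_aux n w x :
  List.Forall (fun l : letter => 0 < snd l x) w ->
  represents (Zminus_aux n (ev x w)) (wt w) (bminus_aux wt n phi w x).
Proof.
  revert w; induction n as [|n IH]; intros w Hw; [apply represents_zero|].
  simpl. apply represents_opp. apply (represents_polar _ (wt w)).
  apply represents_add; [apply represents_Zbar; auto|].
  apply represents_conv_sum; auto.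
Qed.

Lemma laurent_coef_regular y : laurent_coef (lregular y) 0 = laurent_coef y 0.
Proof.
  unfold laurent_coef, lregular; cbn [lord lcoef]. simpl Z.add.
  destruct (Z.ltb_spec (Z.of_nat (lord y)) 0); [lia|].
  rewrite Nat2Z.id, Nat.ltb_irrefl. reflexivity.
Qed.

Lemma zeta_reg_zplus w x :
  List.Forall (fun l : letter => 0 < snd l x) w ->
  zeta_reg (ev x w) = zplus w x (wt w).
Proof.
  intros Hw. unfold zeta_reg, Defs.Zplus. rewrite laurent_coef_regular.
  assert (Hy : represents (ladd (Zbar (ev x w)) (conv_sum Defs.Zminus (ev x w))) (wt w) (zplus w x)).
  { apply represents_add; [apply represents_Zbar; auto|].
    apply represents_conv_sum; auto. intros u Hu. unfold Defs.Zminus, ev at 1. rewrite length_map.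
    apply represents_Zminus_aux; auto. }
  rewrite Hy. unfold zcoef. simpl Z.add.
  destruct (Z.ltb_spec (Z.of_nat (wt w)) 0); [lia|]. rewrite Nat2Z.id. reflexivity.
Qed.

(** * The group of block permutations *)

Lemma NoDup_flat_map {T U} (f : T -> list U) l :
  NoDup l -> (forall a, In a l -> NoDup (f a)) ->
  (forall a b y, In a l -> In b l -> In y (f a) -> In y (f b) -> a = b) ->
  NoDup (flat_map f l).
Proof.
  induction l as [|a l IH]; intros Hl Hf Hd; simpl; [constructor|].
  inversion Hl; subst. apply NoDup_app.
  - apply Hf; left; auto.
  - apply IH; auto with datatypes. intros; eapply Hd; eauto with datatypes.
  - intros y Hy Hy'. apply in_flat_map in Hy' as [b [Hb Hy']].
    assert (a = b) by (apply (Hd a b y); auto with datatypes). subst; contradiction.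
Qed.

(** Deleting [b] undoes its insertion, so insertions into distinct lists never coincide; this yields
    [NoDup_perms]. *)
Lemma ins_filter (b : nat) u w :
  ~ In b u -> In w (ins b u) -> filter (fun c => negb (Nat.eqb c b)) w = u.
Proof.
  revert w; induction u as [|c u IH]; simpl; intros w Hb Hw.
  - destruct Hw as [<-|[]]. simpl. rewrite Nat.eqb_refl. reflexivity.
  - assert (Hc : Nat.eqb c b = false) by (apply Nat.eqb_neq; tauto).
    destruct Hw as [<-|Hw].
    + simpl. rewrite Nat.eqb_refl, Hc. simpl. f_equal.
      clear IH Hc. induction u as [|d u IH]; [reflexivity|]. simpl in *.
      assert (Hd : Nat.eqb d b = false) by (apply Nat.eqb_neq; tauto).
      rewrite Hd. simpl. f_equal. apply IH. tauto.
    + apply in_map_iff in Hw as [v [<- Hv]]. simpl. rewrite Hc. simpl. f_equal.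
      apply IH; tauto.
Qed.

Lemma NoDup_ins (b : nat) u : ~ In b u -> NoDup (ins b u).
Proof.
  induction u as [|c u IH]; simpl; intros Hb; [repeat constructor; auto|].
  constructor.
  - intros H. apply in_map_iff in H as [v [E _]]. inversion E; subst. tauto.
  - apply FinFun.Injective_map_NoDup; [intros x y E; inversion E; auto|]. apply IH; tauto.
Qed.

Lemma NoDup_perms (S : list nat) : NoDup S -> NoDup (perms S).
Proof.
  induction 1 as [|b S Hb HS IH]; simpl; [repeat constructor; auto|].
  assert (Hn : forall u, In u (perms S) -> ~ In b u).
  { intros u Hu Hin. apply Hb. apply perms_perm in Hu. rewrite Hu. exact Hin. }
  apply NoDup_flat_map; auto.
  - intros u Hu. apply NoDup_ins; auto.
  - intros u v w Hu Hv Hwu Hwv.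
    rewrite <- (ins_filter b u w), <- (ins_filter b v w); auto.
Qed.

Lemma perms_complete {T} (S u : list T) : Permutation S u -> In u (perms S).
Proof.
  revert u; induction S as [|b S IH]; intros u Hu; simpl.
  - apply Permutation_nil in Hu as ->. auto.
  - assert (Hb : In b u) by (rewrite <- Hu; left; auto).
    apply in_split in Hb as [u1 [u2 ->]]. apply Permutation_cons_app_inv in Hu.
    apply in_flat_map. exists (u1 ++ u2). split; [apply IH; auto|].
    clear. induction u1 as [|c u1 IH]; simpl.
    + destruct u2; simpl; auto.
    + right. apply in_map; auto.
Qed.

Lemma app_eq_length {T} (u u' v v' : list T) :
  length u = length u' -> u ++ v = u' ++ v' -> u = u' /\ v = v'.
Proof.
  revert u'; induction u as [|a u IH]; intros [|a' u'] H E; simpl in *; try discriminate; auto.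
  inversion E; subst. destruct (IH u') as [-> ->]; auto.
Qed.

Lemma NoDup_words (S : list nat) q : NoDup (letters (S, q)) -> NoDup (words (S, q)).
Proof.
  revert S; induction q as [|[l B] q IH]; intros S H; unfold words, letters in *; cbn [fst snd] in *;
    (apply NoDup_flat_map;
      [apply NoDup_perms; eapply NoDup_app_remove_r; eauto| |
       intros u v w Hu Hv Hwu Hwv; apply in_map_iff in Hwu as [u' [<- _]];
       apply in_map_iff in Hwv as [v' [E _]];
       apply perms_perm, Permutation_length in Hu; apply perms_perm, Permutation_length in Hv;
       symmetry; apply (app_eq_length v u v' u'); congruence]);
    intros u Hu; apply FinFun.Injective_map_NoDup;
    try (intros x y E; apply app_inv_head in E; exact E).
  - repeat constructor; auto.
  - simpl. apply FinFun.Injective_map_NoDup; [intros x y E; inversion E; auto|].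
    apply IH. apply NoDup_app_remove_l in H. simpl in H. inversion H; auto.
Qed.

Section blocks.
Variable s : nat -> Z.

(** The runs of indices with [s i = 0], possibly empty, become the lists to be rearranged; the other
    indices separate them and stay in place. *)
Fixpoint block_pattern (l : list nat) : pattern nat :=
  match l with
  | nil => ([], [])
  | i :: l' =>
      let p := block_pattern l' in
      if Z.eqb (s i) 0 then (i :: fst p, snd p) else ([], (i, fst p) :: snd p)
  end.

Lemma letters_block_pattern l : letters (block_pattern l) = l.
Proof.
  induction l as [|i l IH]; [reflexivity|]. simpl.
  destruct (block_pattern l) as [S q]. unfold letters in *. simpl in *.
  destruct (Z.eqb (s i) 0); simpl; rewrite IH; reflexivity.
Qed.

Definition same_block (i j : nat) : Prop :=
  j = i \/ forall m, (Nat.min i j <= m <= Nat.max i j)%nat -> s m = 0%Z.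

(** Here [m] is the length of the initial run of zeros; the second alternative exposes the first
    index [a + m] outside it and the pattern of the rest, ready for induction on the length. *)
Lemma block_pattern_seq a n : exists m, (m <= n)%nat /\
  (forall j, (a <= j < a + m)%nat -> s j = 0%Z) /\
  ((m = n /\ block_pattern (seq a n) = (seq a m, [])) \/
   ((m < n)%nat /\ s (a + m)%nat <> 0%Z /\
    block_pattern (seq a n)
    = (seq a m, (a + m, fst (block_pattern (seq (S (a + m)) (n - m - 1))))
                :: snd (block_pattern (seq (S (a + m)) (n - m - 1))))%nat)).
Proof.
  revert a; induction n as [|n IH]; intros a.
  - exists 0%nat. split; [lia|split; [intros; lia|left; auto]].
  - simpl. destruct (Z.eqb_spec (s a) 0) as [E|E].
    + destruct (IH (S a)) as [m [H1 [H2 H3]]]. exists (S m). split; [lia|split].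
      * intros j Hj. destruct (Nat.eq_dec j a) as [->|]; [auto|]. apply H2; lia.
      * destruct H3 as [[-> H3]|[H3 [H4 H5]]]; [left|right].
        -- rewrite H3. auto.
        -- replace (a + S m)%nat with (S a + m)%nat by lia.
           replace (S n - S m - 1)%nat with (n - m - 1)%nat by lia.
           split; [lia|split; [auto|]]. rewrite H5. reflexivity.
    + exists 0%nat. split; [lia|split; [intros; lia|right]].
      rewrite Nat.add_0_r. split; [lia|split; [auto|]].
      replace (S n - 1)%nat with n by lia. reflexivity.
Qed.

Lemma Forall2_all {T U} (R : T -> U -> Prop) l l' :
  length l = length l' -> (forall x y, In x l -> In y l' -> R x y) -> Forall2 R l l'.
Proof.
  revert l'; induction l as [|a l IH]; intros [|b l'] H HR; try discriminate; constructor;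
    auto with datatypes.
Qed.

Lemma seq_split a m n :
  (m < n)%nat -> seq a n = seq a m ++ (a + m)%nat :: seq (S (a + m)) (n - m - 1).
Proof.
  intros H. replace n with (m + S (n - m - 1))%nat at 1 by lia. rewrite seq_app. reflexivity.
Qed.

Lemma in_words {T} (S : list T) q w :
  In w (words (S, q)) <-> exists u v, Permutation S u /\ In v (qwords q) /\ w = u ++ v.
Proof.
  unfold words; cbn [fst snd]. rewrite in_flat_map. split.
  - intros [u [Hu Hw]]. apply in_map_iff in Hw as [v [<- Hv]]. exists u, v.
    split; [apply perms_perm|]; auto.
  - intros [u [v [Hu [Hv ->]]]]. exists u. split; [apply perms_complete; auto|].
    apply in_map; auto.
Qed.

Lemma words_block_pattern a n w :
  In w (words (block_pattern (seq a n)))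
  <-> Permutation (seq a n) w /\ Forall2 same_block (seq a n) w.
Proof.
  revert a w; induction n as [n IH] using lt_wf_ind; intros a w.
  destruct (block_pattern_seq a n) as [m [H1 [H2 H3]]].
  assert (HB : forall u, Permutation (seq a m) u -> Forall2 same_block (seq a m) u).
  { intros u Hu. apply Forall2_all; [apply Permutation_length; auto|].
    intros x y Hx Hy. rewrite <- Hu in Hy. apply in_seq in Hx, Hy.
    right. intros j Hj. apply H2. lia. }
  split.
  - intros Hw. split; [rewrite <- (letters_block_pattern (seq a n)) at 1; apply words_perm; auto|].
    destruct H3 as [[-> H3]|[H3 [H4 H5]]].
    + rewrite H3 in Hw. apply in_words in Hw as [u [v [Hu [[<-|[]] ->]]]].
      rewrite app_nil_r. auto.
    + rewrite H5 in Hw. apply in_words in Hw as [u [v [Hu [Hv ->]]]].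
      rewrite (seq_split a m n H3). apply Forall2_app; auto.
      simpl in Hv. apply in_map_iff in Hv as [v' [<- Hv]]. constructor; [left; auto|].
      apply (IH (n - m - 1)%nat); [lia|].
      destruct (block_pattern (seq (S (a + m)) (n - m - 1))); exact Hv.
  - intros [HP HF].
    (* An entry in the same block as some [x < a + m] cannot reach [a + m], where [s] is nonzero. So
       [u] has distinct entries among the first [m] indices, and by counting it contains them
       all. *)
    assert (HC : forall u, incl u w -> Forall2 same_block (seq a m) u -> NoDup u ->
              Permutation (seq a m) u).
    { intros u Hi Hu Hn. symmetry. apply NoDup_Permutation_bis; auto.
      - rewrite (Forall2_length Hu). auto.
      - intros y Hy. apply in_seq. specialize (Hi y Hy). rewrite <- HP in Hi. apply in_seq in Hi.
        split; [lia|]. destruct H3 as [[-> _]|[H3 [H4 _]]]; [lia|].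
        apply Nat.nle_gt. intros Hge. apply H4.
        assert (Hx : exists x, In x (seq a m) /\ same_block x y).
        { clear -Hu Hy. induction Hu as [|x y' l l' Hxy Hu IH]; [easy|].
          destruct Hy as [->|Hy]; [exists x; simpl; auto|].
          destruct (IH Hy) as [x' [? ?]]. exists x'; simpl; auto. }
        destruct Hx as [x [Hx [->|Hz]]]; apply in_seq in Hx; [lia|]. apply Hz. lia. }
    assert (HN : NoDup w) by (rewrite <- HP; apply seq_NoDup).
    destruct H3 as [[-> H3]|[H3 [H4 H5]]].
    + rewrite H3. apply in_words. exists w, []. rewrite app_nil_r. simpl. auto.
    + rewrite H5. apply in_words.
      rewrite (seq_split a m n H3) in HF. apply Forall2_app_inv_l in HF as [u [v [Hu [Hv ->]]]].
      assert (Pu : Permutation (seq a m) u).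
      { apply HC; auto; [intros y Hy; apply in_or_app; auto|]. eapply NoDup_app_remove_r; eauto. }
      exists u, v. split; [auto|split; [|auto]].
      inversion Hv as [|? y ? v' Hy Hv']; subst.
      assert (Ey : y = (a + m)%nat).
      { destruct Hy as [->|Hz]; [auto|]. exfalso; apply H4, Hz; lia. }
      subst y. simpl. apply in_map.
      assert (In v' (words (block_pattern (seq (S (a + m)) (n - m - 1))))) as HI.
      { apply (IH (n - m - 1)%nat); [lia|]. split; [|auto].
        rewrite (seq_split a m n H3), Pu in HP.
        apply Permutation_app_inv_l, Permutation_cons_inv in HP. exact HP. }
      destruct (block_pattern (seq (S (a + m)) (n - m - 1))); exact HI.
Qed.

End blocks.

Lemma same_zero_block_spec s i j :
  same_zero_block s i j = true
  <-> forall m, (Nat.min i j <= m <= Nat.max i j)%nat -> s m = 0%Z.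
Proof.
  unfold same_zero_block. rewrite forallb_forall. split; intros H m Hm.
  - apply Z.eqb_eq, H, in_seq. lia.
  - apply Z.eqb_eq, H. apply in_seq in Hm. lia.
Qed.

Lemma all_lists_spec k n l :
  In l (all_lists k n) <-> length l = n /\ List.Forall (fun i => (i < k)%nat) l.
Proof.
  revert l; induction n as [|n IH]; intros l; simpl.
  - split; [intros [<-|[]]; auto|]. intros [H _]. destruct l; [auto|discriminate].
  - rewrite in_flat_map. split.
    + intros [l' [Hl' Hl]]. apply in_map_iff in Hl as [i [<- Hi]]. apply in_seq in Hi.
      apply IH in Hl' as [H1 H2]. split; [simpl; auto|]. constructor; auto; lia.
    + intros [H1 H2]. destruct H2 as [|i l Hi Hl]; [discriminate|].
      exists l. split; [apply IH; auto|]. apply (in_map (fun a => a :: l)), in_seq. lia.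
Qed.

Lemma NoDup_all_lists k n : NoDup (all_lists k n).
Proof.
  induction n as [|n IH]; simpl; [repeat constructor; auto|].
  apply NoDup_flat_map; auto.
  - intros l _. apply FinFun.Injective_map_NoDup; [intros x y E; inversion E; auto|].
    apply seq_NoDup.
  - intros l l' w _ _ H H'. apply in_map_iff in H as [i [<- _]].
    apply in_map_iff in H' as [j [E _]]. inversion E; auto.
Qed.

Lemma Forall2_seq (R : nat -> nat -> Prop) a l :
  Forall2 R (seq a (length l)) l
  <-> forall i, (i < length l)%nat -> R (a + i)%nat (nth i l 0%nat).
Proof.
  revert a; induction l as [|b l IH]; intros a; simpl.
  - split; [intros; lia|constructor].
  - split.
    + intros H [|i] Hi; inversion H; subst; [rewrite Nat.add_0_r; auto|].
      rewrite <- Nat.add_succ_comm. apply IH; auto; lia.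
    + intros H. constructor; [specialize (H 0%nat); rewrite Nat.add_0_r in H; apply H; lia|].
      apply IH. intros i Hi. rewrite Nat.add_succ_comm. apply (H (S i)). lia.
Qed.

(** Both lists are free of duplicates, so it suffices to compare members: the permutations in the
    group are those that keep each index in its own block. *)
Lemma Sigma_words k s :
  Permutation (filter (in_Sigma k s) (all_lists k k)) (words (block_pattern s (seq 0 k))).
Proof.
  apply NoDup_Permutation.
  - apply NoDup_filter, NoDup_all_lists.
  - pose proof (letters_block_pattern s (seq 0 k)) as E.
    destruct (block_pattern s (seq 0 k)) as [S q]. apply NoDup_words.
    rewrite E. apply seq_NoDup.
  - intros l. rewrite filter_In, all_lists_spec, words_block_pattern.
    unfold in_Sigma, is_perm_b. rewrite Bool.andb_true_iff, !forallb_forall. split.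
    + intros [[Hl HF] [Hi Hb]]. subst k. split.
      * symmetry. apply NoDup_Permutation_bis.
        -- apply (NoDup_nth l 0%nat). intros i j Hli Hlj E.
           specialize (Hi i ltac:(apply in_seq; lia)). rewrite forallb_forall in Hi.
           specialize (Hi j ltac:(apply in_seq; lia)). rewrite E, Nat.eqb_refl in Hi.
           simpl in Hi. rewrite Bool.orb_false_r in Hi. apply Nat.eqb_eq; auto.
        -- rewrite length_seq; auto.
        -- intros i Hin. apply in_seq. rewrite List.Forall_forall in HF. specialize (HF i Hin). lia.
      * apply Forall2_seq. intros i Hli. specialize (Hb i ltac:(apply in_seq; lia)).
        apply Bool.orb_true_iff in Hb as [Hb|Hb]; [left; apply Nat.eqb_eq; auto|].
        right. apply same_zero_block_spec; auto.
    + intros [HP HF]. assert (Hl : length l = k) by (rewrite <- HP; apply length_seq).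
      split; [split; [auto|]|split].
      * apply List.Forall_forall. intros i Hin. rewrite <- HP in Hin. apply in_seq in Hin. lia.
      * intros i Hin. apply forallb_forall. intros j Hjn. apply in_seq in Hin, Hjn.
        destruct (Nat.eqb_spec i j) as [|Hij]; [reflexivity|].
        apply Bool.negb_true_iff, Nat.eqb_neq. intros E. apply Hij.
        assert (HN : NoDup l) by (rewrite <- HP; apply seq_NoDup).
        apply (proj1 (NoDup_nth l 0%nat) HN); auto; lia.
      * intros i Hin. apply in_seq in Hin. subst k.
        apply Bool.orb_true_iff. destruct (proj1 (Forall2_seq _ _ _) HF i ltac:(lia)) as [E|Hz].
        -- left. apply Nat.eqb_eq. exact E.
        -- right. apply same_zero_block_spec. exact Hz.
Qed.

Lemma lsumR_perm {T} (l l' : list T) f : Permutation l l' -> lsumR l f = lsumR l' f.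
Proof.
  induction 1; simpl; [reflexivity|rewrite IHPermutation; reflexivity|ring|].
  etransitivity; eauto.
Qed.

Lemma lsumR_filter {T} (l : list T) (b : T -> bool) f :
  fold_right Rplus 0 (map (fun a => if b a then f a else 0) l) = lsumR (filter b l) f.
Proof.
  induction l as [|a l IH]; simpl; [reflexivity|]. rewrite IH.
  destruct (b a); simpl; ring.
Qed.

Definition pmap {T U} (f : T -> U) (p : pattern T) : pattern U :=
  (map f (fst p), map (fun t => (f (fst t), map f (snd t))) (snd p)).

Lemma words_pmap {T U} (f : T -> U) p : words (pmap f p) = map (map f) (words p).
Proof.
  assert (H : forall S q q', qwords q' = map (map f) (qwords q) ->
     flat_map (fun u => map (app u) (qwords q')) (perms (map f S))
     = map (map f) (flat_map (fun u => map (app u) (qwords q)) (perms S))).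
  { intros S q q' E. rewrite E, perms_map.
    induction (perms S) as [|u l IH]; simpl; [reflexivity|].
    rewrite IH, map_app, !map_map. f_equal. apply map_ext. intros v. rewrite map_app. reflexivity. }
  unfold words, pmap; cbn [fst snd]. apply H.
  induction (snd p) as [|[l B] q IH]; [reflexivity|]. simpl.
  rewrite (H B q _ IH), !map_map. reflexivity.
Qed.

Lemma letters_pmap {T U} (f : T -> U) p : letters (pmap f p) = map f (letters p).
Proof.
  unfold letters, pmap; cbn [fst snd]. rewrite map_app. f_equal.
  induction (snd p) as [|[l B] q IH]; [reflexivity|]. simpl. rewrite IH, map_app. reflexivity.
Qed.

(** * The theorem *)

(** Neighbourhoods of [- s] in the first [k] coordinates, within the positive parameters; the other
    coordinates are free. *)
Definition param_filter (k : nat) (s : nat -> Z) (P : X -> Prop) : Prop :=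
  exists d, 0 < d /\
    forall x : X, (forall i, (i < k)%nat -> Rabs (x i + IZR (s i)) < d) -> P x.

#[local] Instance param_filter_filter k s : Filter (param_filter k s).
Proof.
  split.
  - exists 1; split; [lra|auto].
  - intros P Q [d1 [D1 H1]] [d2 [D2 H2]]. exists (Rmin d1 d2). split; [apply Rmin_pos; auto|].
    intros x Hx. split; [apply H1|apply H2]; intros i Hi; specialize (Hx i Hi);
      pose proof (Rmin_l d1 d2); pose proof (Rmin_r d1 d2); lra.
  - intros P Q HPQ [d [D H]]. exists d; auto.
Qed.

Definition letter_of (s : nat -> Z) (i : nat) : letter := (Z.to_nat (- s i), fun x : X => pos (x i)).

Lemma letter_of_lim k s i :
  (i < k)%nat ->
  filterlim (snd (letter_of s i)) (param_filter k s) (locally (- IZR (s i))).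
Proof.
  intros Hi P [eps HP]. exists eps. split; [apply cond_pos|]. intros x Hx. apply HP.
  specialize (Hx i Hi). unfold ball; simpl. unfold AbsRing_ball, abs, minus, plus, opp; simpl.
  rewrite Ropp_involutive. exact Hx.
Qed.

Lemma letter_of_pos s i : Vpos (snd (letter_of s i)).
Proof. intros x. apply cond_pos. Qed.

Lemma block_pattern_valid k s l :
  (forall i, (i < k)%nat -> (s i <= 0)%Z) -> List.Forall (fun i => (i < k)%nat) l ->
  valid (F := param_filter k s) (pmap (letter_of s) (block_pattern s l)).
Proof.
  intros Hs Hl. induction Hl as [|i l Hi Hl [IH1 IH2]]; [split; constructor|].
  simpl. specialize (Hs i Hi). pose proof (letter_of_lim k s i Hi) as HL.
  destruct (Z.eqb_spec (s i) 0) as [E|E]; split; cbn [fst snd pmap map] in *.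
  - constructor; auto. split; [simpl; rewrite E; reflexivity|]. split; [apply letter_of_pos|].
    rewrite E, Ropp_0 in HL. exact HL.
  - exact IH2.
  - constructor.
  - constructor; auto. split; [|exact IH1]. split; [simpl; lia|]. split; [apply letter_of_pos|].
    exists (- IZR (s i)). split; [|exact HL].
    assert (IZR (s i) < 0) by (apply IZR_lt; lia). lra.
Qed.

(** A permutation of the group moves only indices inside zero blocks, where [s] is constant;
    permuting the parameters alone is therefore the same as permuting the letters. *)
Lemma zeta_sym_words k s (x : X) :
  (forall i, (i < k)%nat -> (s i <= 0)%Z) ->
  zeta_sym k s (fun i => pos (x i))
  = Sum (words (pmap (letter_of s) (block_pattern s (seq 0 k)))) zplus x
        (wt (letters (pmap (letter_of s) (block_pattern s (seq 0 k))))).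
Proof.
  intros Hs. unfold zeta_sym. rewrite lsumR_filter, (lsumR_perm _ _ _ (Sigma_words k s)).
  rewrite words_pmap, Sum_map, letters_pmap, letters_block_pattern.
  assert (H : forall l, In l (words (block_pattern s (seq 0 k))) ->
     zeta k s (fun i => pos (x (nth i l 0%nat)))
     = zplus (map (letter_of s) l) x (wt (map (letter_of s) (seq 0 k)))).
  { intros l Hl. apply words_block_pattern in Hl as [HP HF].
    assert (El : length l = k) by (rewrite <- HP; apply length_seq).
    rewrite (wt_perm _ _ (Permutation_map (letter_of s) HP)).
    rewrite <- zeta_reg_zplus.
    - unfold zeta. f_equal. unfold mkword, ev. rewrite map_map.
      rewrite <- El in HF. rewrite <- El at 1.
      assert (Hb : List.Forall (fun i => (i < k)%nat) l).
      { apply List.Forall_forall. intros i Hin. rewrite <- HP in Hin. apply in_seq in Hin. lia. }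
      clear HP.
      assert (G : forall a l, Forall2 (same_block s) (seq a (length l)) l ->
        List.Forall (fun i => (i < k)%nat) l ->
        forall f : nat -> nat, (forall i, (i < length l)%nat -> f (a + i)%nat = nth i l 0%nat) ->
        map (fun i => (s i, pos (x (f i)))) (seq a (length l))
        = map (fun i => ((- Z.of_nat (fst (letter_of s i)))%Z, snd (letter_of s i) x)) l).
      { clear l El HF Hb. intros a l; revert a; induction l as [|j l IH]; intros a HF Hb f Hf;
          [reflexivity|].
        simpl in HF |- *. inversion HF as [|? ? ? ? Hj HF']; inversion Hb as [|? ? Hjk Hb']; subst.
        f_equal.
        - assert (Ef : f a = j) by (rewrite <- (Nat.add_0_r a); apply (Hf 0%nat); simpl; lia).
          rewrite Ef. f_equal. specialize (Hs j Hjk).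
          assert (E : s a = s j).
          { destruct Hj as [->|Hz]; [reflexivity|]. rewrite (Hz a), (Hz j) by lia. reflexivity. }
          rewrite E. lia.
        - apply IH; auto. intros i Hi. rewrite Nat.add_succ_comm. apply (Hf (S i)). simpl; lia. }
      apply G; auto.
    - apply List.Forall_forall. intros t Ht. apply in_map_iff in Ht as [i [<- _]].
      apply letter_of_pos. }
  revert H. generalize (words (block_pattern s (seq 0 k))) as ls.
  induction ls as [|l ls IH]; intros H; cbn [Sum lsumR fold_right].
  - unfold f0. destruct (wt _); reflexivity.
  - unfold fadd, sadd. rewrite <- IH by auto with datatypes. rewrite <- H by auto with datatypes.
    reflexivity.
Qed.

Lemma zeta_sym_ext k s r r' :
  (forall i, (i < k)%nat -> r i = r' i) -> zeta_sym k s r = zeta_sym k s r'.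
Proof.
  intros H. unfold zeta_sym. f_equal. apply map_ext_in. intros l Hl.
  destruct (in_Sigma k s l); [|reflexivity]. unfold zeta. f_equal.
  unfold mkword. apply map_ext_in. intros i Hi. apply in_seq in Hi. f_equal. apply H.
  apply all_lists_spec in Hl as [El HF]. rewrite List.Forall_forall in HF. apply HF, nth_In. lia.
Qed.

(** Positivity is known for the first [k] coordinates only; any other coordinate that fails it is
    set to 1, which does not affect [zeta_sym] by [zeta_sym_ext]. *)
Definition positive_point (r : nat -> R) : X :=
  fun i => match Rlt_dec 0 (r i) with
           | left H => mkposreal (r i) H
           | right _ => mkposreal 1 Rlt_0_1
           end.

Theorem theorem4p12 (k : nat) (s : nat -> Z) :
  (forall i, (i < k)%nat -> (s i <= 0)%Z) ->
  exists L : R, forall e : R, 0 < e ->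
    exists d : R, 0 < d /\
      forall r : nat -> R,
        (forall i, (i < k)%nat -> 0 < r i) ->
        (exists i, (i < k)%nat /\ r i <> - IZR (s i)) ->
        (forall i, (i < k)%nat -> Rabs (r i + IZR (s i)) < d) ->
        Rabs (zeta_sym k s r - L) < e.
Proof.
  intros Hs. destruct k as [|k].
  (* For [k = 0] no [r] differs from [- s] at an index below [k], so any value serves as limit. *)
  { exists 0. intros e He. exists 1. split; [lra|]. intros r _ [i [Hi _]]; lia. }
  set (p := pmap (letter_of s) (block_pattern s (seq 0 (S k)))).
  assert (Hp : valid (F := param_filter (S k) s) p).
  { apply block_pattern_valid; auto. apply List.Forall_forall. intros i Hi.
    apply in_seq in Hi; lia. }
  assert (Hn : psize p <> 0%nat).
  { rewrite <- letters_length. unfold p. rewrite letters_pmap, letters_block_pattern.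
    rewrite length_map, length_seq. discriminate. }
  destruct (zplus_limit p Hp Hn) as [L HL].
  exists L. intros e He.
  destruct (HL (fun y => Rabs (y - L) < e)) as [d [Hd H]].
  { exists (mkposreal e He). intros y Hy. exact Hy. }
  exists d; split; auto. intros r Hr _ Hd'.
  assert (Ex : forall i, (i < S k)%nat -> r i = positive_point r i).
  { intros i Hi. unfold positive_point. destruct (Rlt_dec 0 (r i)) as [|N]; [reflexivity|].
    specialize (Hr i Hi); lra. }
  rewrite (zeta_sym_ext _ _ _ _ Ex), zeta_sym_words by auto.
  apply H. intros i Hi. rewrite <- Ex by auto. auto.
Qed.
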